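(* Let $G$ be a smooth affine algebraic group scheme over a commutative ring $k$. (a) If $G$ has a functorial Reynolds operator, then $G$ is linearly reductive. (b) Assume that $k$ is a Dedekind domain. If $G$ is linearly reductive over $k$, then $G$ has a functorial Reynolds operator.
   Context: All rings are unital. ''Algebraic'' means of finite type over $k$. For an affine group scheme $G$ over $k$, a $G$-module is a $k$-module $V$ together with, functorially in $k$-algebras $A$, an $A$-linear action of $G(A)$ on $V\otimes_k A$; equivalently, a comodule $\Delta_V: V\to V\otimes_k k[G]$ over the Hopf algebra $k[G]$. Homomorphisms of $G$-modules ($G$-equivariant homomorphisms) are $k$-linear maps compatible with the comodule maps. The invariants are $V^G=\{v\in V\mid \Delta_V(v)=v\otimes 1\}$. For $G$ flat over $k$, $H^i(G,V)$ denotes Hochschild cohomology, i.e. the $i$-th right derived functor of $V\mapsto V^G$ on the category of $G$-modules. A flat affine group scheme $G$ over $k$ is linearly reductive if $H^1(G,V)=0$ for all $G$-modules $V$. A Reynolds operator for a $G$-module $V$ is a $G$-equivariant homomorphism $\mathcal{R}_G: V\to V^G$ with $\mathcal{R}_G(V)=V^G$ and $\mathcal{R}_G|_{V^G}=\mathrm{id}$. A functorial Reynolds operator for $G$ is a choice of Reynolds operator for every $G$-module such that for every homomorphism of $G$-modules $\varphi: V\to W$ one has $\mathcal{R}_G\circ\varphi=\varphi|_{V^G}\circ\mathcal{R}_G$. *)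

(* Defs.v *)
From HB Require Import structures.
From mathcomp Require Import all_boot all_order all_algebra.
From mathcomp Require Import generic_quotient ring_quotient sesquilinear.
From mathcomp Require Import boolp.
From mathcomp Require Import mpoly.

Set Implicit Arguments.
Unset Strict Implicit.
Unset Printing Implicit Defensive.

Import GRing.Theory.
Local Open Scope ring_scope.
Local Open Scope quotient_scope.

Section Tensor.
Variables (k : comNzRingType) (V W : lmodType k).

(* The abelian group V ⊗ W is presented by generators (v, w) and the usual
   relations; a list stands for the sum of its entries.  Negation needs no
   separate generators since - (v ⊗ w) = (- v) ⊗ w. *)
Inductive tens_rel : seq (V * W) -> seq (V * W) -> Prop :=
| tens_rel_perm s t of perm_eq s t : tens_rel s t
| tens_rel_sym s t of tens_rel s t : tens_rel t s
| tens_rel_trans s t u of tens_rel s t & tens_rel t u : tens_rel s u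
| tens_rel_cat s s' t t' of tens_rel s s' & tens_rel t t' :
    tens_rel (s ++ t) (s' ++ t')
| tens_rel_0 w : tens_rel [:: (0, w)] [::]
| tens_rel_Dl v v' w : tens_rel [:: (v + v', w)] [:: (v, w); (v', w)]
| tens_rel_Dr v w w' : tens_rel [:: (v, w + w')] [:: (v, w); (v, w')]
| tens_rel_Z a v w : tens_rel [:: (a *: v, w)] [:: (v, a *: w)].

Definition tens_relb (s t : seq (V * W)) : bool := `[< tens_rel s t >].

Lemma tens_relbP s t : reflect (tens_rel s t) (tens_relb s t).
Proof. exact: asboolP. Qed.

Lemma tens_relb_refl : reflexive tens_relb.
Proof. by move=> s; apply/tens_relbP/tens_rel_perm. Qed.

Lemma tens_relb_sym : ssrbool.symmetric tens_relb.
Proof. by move=> s t; apply/tens_relbP/tens_relbP; apply: tens_rel_sym. Qed.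

Lemma tens_relb_trans : transitive tens_relb.
Proof.
move=> t s u /tens_relbP st /tens_relbP tu.
exact/tens_relbP/(tens_rel_trans st tu).
Qed.

Canonical tens_equiv :=
  EquivRel tens_relb tens_relb_refl tens_relb_sym tens_relb_trans.

Definition tensor : Type := {eq_quot tens_equiv}.
HB.instance Definition _ := Choice.on tensor.

Definition tens_class (s : seq (V * W)) : tensor := \pi_{eq_quot tens_equiv} s.

Lemma tens_classP s t : tens_class s = tens_class t <-> tens_rel s t.
Proof.
split=> [/eqP|st]; first by rewrite piE => /tens_relbP.
by apply/eqP; rewrite piE; apply/tens_relbP.
Qed.

Lemma tens_reprK t : tens_class (repr t) = t.
Proof. exact: reprK. Qed.

Lemma tens_rel_repr s : tens_rel (repr (tens_class s)) s.
Proof. by apply/tens_classP; rewrite tens_reprK. Qed.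

Definition pure (v : V) (w : W) : tensor := tens_class [:: (v, w)].

Definition tens_scale_seq (a : k) (s : seq (V * W)) :=
  [seq (a *: p.1, p.2) | p <- s].

Lemma tens_rel_scale a s t :
  tens_rel s t -> tens_rel (tens_scale_seq a s) (tens_scale_seq a t).
Proof.
elim=> {s t} /= [s t st|s t _|s t u _ + _|s s' t t' _ Hs _ Ht|w|v v' w|v w w'|b v w].
- exact/tens_rel_perm/perm_map.
- exact: tens_rel_sym.
- exact: tens_rel_trans.
- by rewrite /tens_scale_seq !map_cat; apply: tens_rel_cat.
- by rewrite scaler0; apply: tens_rel_0.
- by rewrite scalerDr; apply: tens_rel_Dl.
- exact: tens_rel_Dr.
- by rewrite scalerA mulrC -scalerA; apply: tens_rel_Z.
Qed.

Definition tens_zero : tensor := tens_class [::].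
Definition tens_add (t u : tensor) : tensor := tens_class (repr t ++ repr u).
Definition tens_scale a (t : tensor) : tensor :=
  tens_class (tens_scale_seq a (repr t)).
Definition tens_opp (t : tensor) : tensor := tens_scale (-1) t.

Lemma tens_addE s t : tens_add (tens_class s) (tens_class t) = tens_class (s ++ t).
Proof. by apply/tens_classP; apply: tens_rel_cat; apply: tens_rel_repr. Qed.

Lemma tens_scaleE a s :
  tens_scale a (tens_class s) = tens_class (tens_scale_seq a s).
Proof. exact/tens_classP/tens_rel_scale/tens_rel_repr. Qed.

Lemma tens_addA : associative tens_add.
Proof.
move=> x y z; rewrite -(tens_reprK x) -(tens_reprK y) -(tens_reprK z).
by rewrite !tens_addE catA.
Qed.

Lemma tens_addC : commutative tens_add.
Proof.
move=> x y; rewrite -(tens_reprK x) -(tens_reprK y) !tens_addE.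
by apply/tens_classP/tens_rel_perm; rewrite perm_catC.
Qed.

Lemma tens_add0 : left_id tens_zero tens_add.
Proof. by move=> x; rewrite -(tens_reprK x) tens_addE. Qed.

Lemma tens_rel_D2l a b s :
  tens_rel (tens_scale_seq a s ++ tens_scale_seq b s) (tens_scale_seq (a + b) s).
Proof.
elim: s => [|p s IHs] /=; first exact: tens_rel_perm.
apply: (@tens_rel_trans _ ([:: (a *: p.1, p.2); (b *: p.1, p.2)] ++
   (tens_scale_seq a s ++ tens_scale_seq b s))).
  apply: tens_rel_perm; rewrite /= perm_cons.
  by rewrite -[_ :: tens_scale_seq b s]cat1s perm_catCA.
rewrite -[X in tens_rel _ X]cat1s; apply: tens_rel_cat => //.
by rewrite scalerDl; apply/tens_rel_sym/tens_rel_Dl.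
Qed.

Lemma tens_rel_scale0 s : tens_rel (tens_scale_seq 0 s) [::].
Proof.
elim: s => [|p s IHs] /=; first exact: tens_rel_perm.
rewrite -[_ :: _]cat1s -[[::]]cats0; apply: tens_rel_cat => //.
by rewrite scale0r; apply: tens_rel_0.
Qed.

Lemma tens_scale_seq1 s : tens_scale_seq 1 s = s.
Proof. by elim: s => [|[v w] s] //= ->; rewrite scale1r. Qed.

Lemma tens_addN : left_inverse tens_zero tens_opp tens_add.
Proof.
move=> x; rewrite -(tens_reprK x) /tens_opp tens_scaleE tens_addE.
apply/tens_classP; rewrite -[X in _ ++ X]tens_scale_seq1.
by apply: tens_rel_trans (tens_rel_D2l _ _ _) _; rewrite addNr; apply: tens_rel_scale0.
Qed.

HB.instance Definition _ :=
  GRing.isZmodule.Build tensor tens_addA tens_addC tens_add0 tens_addN.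

Lemma tens_classD s t : tens_class s + tens_class t = tens_class (s ++ t).
Proof. exact: tens_addE. Qed.

Lemma tens_scaleA a b x : tens_scale a (tens_scale b x) = tens_scale (a * b) x.
Proof.
rewrite -(tens_reprK x) !tens_scaleE /tens_scale_seq -map_comp.
by congr tens_class; apply: eq_map => p /=; rewrite scalerA.
Qed.

Lemma tens_scale1 : left_id 1 tens_scale.
Proof. by move=> x; rewrite -(tens_reprK x) tens_scaleE tens_scale_seq1. Qed.

Lemma tens_scaleDr : right_distributive tens_scale +%R.
Proof.
move=> a x y; rewrite -(tens_reprK x) -(tens_reprK y) tens_classD !tens_scaleE.
by rewrite tens_classD /tens_scale_seq map_cat.
Qed.

Lemma tens_scaleDl x : {morph tens_scale^~ x : a b / a + b}.
Proof.
move=> a b; rewrite -(tens_reprK x) !tens_scaleE.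
rewrite tens_classD; apply/esym/tens_classP/tens_rel_D2l.
Qed.

HB.instance Definition _ := GRing.Zmodule_isLmodule.Build k tensor
  tens_scaleA tens_scale1 tens_scaleDr tens_scaleDl.

Lemma tens_class_sum s : tens_class s = \sum_(p <- s) pure p.1 p.2.
Proof.
elim: s => [|[v w] s IHs]; first by rewrite big_nil.
by rewrite big_cons -IHs tens_classD.
Qed.

Lemma tens_sum_repr t : t = \sum_(p <- repr t) pure p.1 p.2.
Proof. by rewrite -tens_class_sum tens_reprK. Qed.

Lemma pure_bilinear : bilinear_for *:%R *:%R pure.
Proof.
split=> [w a v v'|v a w w'] /=.
- rewrite [pure (_ + _) _](_ : _ = pure (a *: v) w + pure v' w); last first.
    by rewrite tens_classD; apply/tens_classP/tens_rel_Dl.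
  by congr (_ + _); rewrite [RHS]tens_scaleE.
- rewrite [pure _ (_ + _)](_ : _ = pure v (a *: w) + pure v w'); last first.
    by rewrite tens_classD; apply/tens_classP/tens_rel_Dr.
  congr (_ + _); rewrite [RHS]tens_scaleE; apply/esym/tens_classP/tens_rel_Z.
Qed.

HB.instance Definition _ := bilinear_isBilinear.Build k V W tensor
  *:%R *:%R pure pure_bilinear.

Section Lift.
Variable U : lmodType k.

(* The linear map V ⊗ W -> U induced by b; independent of the representative
   only when b is bilinear. *)
Definition tens_lift (b : V -> W -> U) (t : tensor) : U :=
  \sum_(p <- repr t) b p.1 p.2.

Variable b : V -> W -> U.
Hypothesis b_bilinear : bilinear_for *:%R *:%R b.

Let bl w := b_bilinear.1 w.
Let br v := b_bilinear.2 v.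

Lemma tens_rel_sum s t :
  tens_rel s t -> \sum_(p <- s) b p.1 p.2 = \sum_(p <- t) b p.1 p.2.
Proof.
have bD v v' w : b (v + v') w = b v w + b v' w.
  by have := bl w 1 v v'; rewrite /= !scale1r.
have bD' v w w' : b v (w + w') = b v w + b v w'.
  by have := br v 1 w w'; rewrite /= !scale1r.
have b0 w : b 0 w = 0 by apply: (addrI (b 0 w)); rewrite -bD !addr0.
have b0' v : b v 0 = 0 by apply: (addrI (b v 0)); rewrite -bD' !addr0.
elim=> {s t} [s t st|s t _ //|s t u _ -> //|s s' t t' _ Hs _ Ht|w|v v' w|v w w'|a v w].
- exact: perm_big.
- by rewrite !big_cat Hs Ht.
- by rewrite big_seq1 big_nil b0.
- by rewrite big_seq1 big_cons big_seq1 bD.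
- by rewrite big_seq1 big_cons big_seq1 bD'.
- rewrite !big_seq1 /=; have := bl w a v 0; have := br v a w 0.
  by rewrite /= b0 b0' !addr0 => -> ->.
Qed.

Lemma tens_lift_class s : tens_lift b (tens_class s) = \sum_(p <- s) b p.1 p.2.
Proof. exact/tens_rel_sum/tens_rel_repr. Qed.

Lemma tens_lift_pure v w : tens_lift b (pure v w) = b v w.
Proof. by rewrite tens_lift_class big_seq1. Qed.

Lemma tens_lift_linear : linear (tens_lift b).
Proof.
move=> a x y; rewrite -(tens_reprK x) -(tens_reprK y).
rewrite [X in X + _]tens_scaleE tens_classD !tens_lift_class big_cat /=.
congr (_ + _); rewrite big_map scaler_sumr; apply: eq_bigr => -[v w] _ /=.
have /= := bl w a v 0; rewrite addr0 => ->.
suff -> : b 0 w = 0 by rewrite addr0.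
have /= := bl w 1 0 0; rewrite !scale1r addr0 => b00.
by apply: (addrI (b 0 w)); rewrite -b00 addr0.
Qed.

End Lift.

Lemma tens_ext (U : lmodType k) (f g : {linear tensor -> U}) :
  (forall v w, f (pure v w) = g (pure v w)) -> f =1 g.
Proof.
move=> fg t; rewrite (tens_sum_repr t) !linear_sum.
by apply: eq_bigr => p _; apply: fg.
Qed.

End Tensor.

Notation "v *t w" := (pure v w) (at level 40, left associativity) : ring_scope.

Section TensorMaps.
Variable k : comNzRingType.

Definition tens_map (V W V' W' : lmodType k) (f : V -> V') (g : W -> W') :
    tensor V W -> tensor V' W' :=
  tens_lift (fun v w => f v *t g w).

Definition tens_assoc (U V W : lmodType k) :
    tensor (tensor U V) W -> tensor U (tensor V W) :=
  tens_lift (fun t w => tens_lift (fun u v => u *t (v *t w)) t).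

Definition tens_mul (A B : comAlgType k) (x y : tensor A B) : tensor A B :=
  tens_lift (fun a b => tens_lift (fun a' b' => (a * a') *t (b * b')) y) x.

Lemma tens_map_bilinear (V W V' W' : lmodType k)
    (f : {linear V -> V'}) (g : {linear W -> W'}) :
  bilinear_for *:%R *:%R (fun v w => f v *t g w).
Proof. by split=> [w|v] a x y /=; rewrite linearP (linearPl, linearPr). Qed.

Lemma tens_map_pure (V W V' W' : lmodType k)
    (f : {linear V -> V'}) (g : {linear W -> W'}) v w :
  tens_map f g (v *t w) = f v *t g w.
Proof. exact: (tens_lift_pure (tens_map_bilinear f g)). Qed.

HB.instance Definition _ (V W V' W' : lmodType k)
    (f : {linear V -> V'}) (g : {linear W -> W'}) :=
  GRing.isLinear.Build k (tensor V W) (tensor V' W') *:%R (tens_map f g)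
    (tens_lift_linear (tens_map_bilinear f g)).

Lemma tens_assoc_bilinear1 (U V W : lmodType k) (w : W) :
  bilinear_for *:%R *:%R (fun (u : U) (v : V) => u *t (v *t w)).
Proof. by split=> [v|u] a x y /=; rewrite ?linearPl ?linearPr. Qed.

Lemma tens_assoc_bilinear (U V W : lmodType k) :
  bilinear_for *:%R *:%R
    (fun (t : tensor U V) (w : W) => tens_lift (fun u v => u *t (v *t w)) t).
Proof.
split=> [w|t] a x y /=; first exact: (tens_lift_linear (tens_assoc_bilinear1 U V w)).
rewrite /tens_lift scaler_sumr -big_split /=; apply: eq_bigr => p _.
by rewrite !linearPr.
Qed.

Lemma tens_assoc_pure (U V W : lmodType k) (u : U) (v : V) (w : W) :
  tens_assoc (u *t v *t w) = u *t (v *t w).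
Proof.
rewrite /tens_assoc (tens_lift_pure (tens_assoc_bilinear _ _ _)).
by rewrite (tens_lift_pure (tens_assoc_bilinear1 _ _ _)).
Qed.

HB.instance Definition _ (U V W : lmodType k) :=
  GRing.isLinear.Build k (tensor (tensor U V) W) (tensor U (tensor V W)) *:%R
    (@tens_assoc U V W) (tens_lift_linear (tens_assoc_bilinear U V W)).

Lemma tens_mul_bilinear1 (A B : comAlgType k) (a : A) (b : B) :
  bilinear_for *:%R *:%R (fun (a' : A) (b' : B) => (a * a') *t (b * b')).
Proof.
by split=> [b'|a'] c x y /=; rewrite mulrDr -scalerAr (linearPl, linearPr).
Qed.

Lemma tens_mul_bilinear (A B : comAlgType k) (y : tensor A B) :
  bilinear_for *:%R *:%R
    (fun (a : A) (b : B) => tens_lift (fun a' b' => (a * a') *t (b * b')) y).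
Proof.
split=> [b|a] c x z /=; rewrite /tens_lift scaler_sumr -big_split /=;
  by apply: eq_bigr => p _; rewrite mulrDl -scalerAl (linearPl, linearPr).
Qed.

Lemma tens_mul_pure (A B : comAlgType k) (a a' : A) (b b' : B) :
  tens_mul (a *t b) (a' *t b') = (a * a') *t (b * b').
Proof.
rewrite /tens_mul (tens_lift_pure (tens_mul_bilinear _)).
by rewrite (tens_lift_pure (tens_mul_bilinear1 _ _)).
Qed.

End TensorMaps.

(* An affine group scheme over k, given by its commutative Hopf algebra. *)
Record affine_group (k : comNzRingType) := AffineGroup {
  coord_ring : comAlgType k;
  comul : {linear coord_ring -> tensor coord_ring coord_ring};
  counit : {lrmorphism coord_ring -> k | *%R};
  antipode : {lrmorphism coord_ring -> coord_ring};
  comul1 : comul 1 = 1 *t 1;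
  comulM : forall a b, comul (a * b) = tens_mul (comul a) (comul b);
  comulA : forall a,
    tens_assoc (tens_map comul idfun (comul a)) = tens_map idfun comul (comul a);
  counitl : forall a, tens_lift (fun x y => counit x *: y) (comul a) = a;
  counitr : forall a, tens_lift (fun x y => counit y *: x) (comul a) = a;
  antipodel : forall a,
    tens_lift (fun x y => antipode x * y) (comul a) = (counit a)%:A;
  antipoder : forall a,
    tens_lift (fun x y => x * antipode y) (comul a) = (counit a)%:A
}.

Section AlgebraProperties.
Variables (k : comNzRingType) (A : comAlgType k).

Definition flat_module (M : lmodType k) : Prop :=
  forall (V W : lmodType k) (f : {linear V -> W}),
    injective f -> injective (tens_map f (@idfun M)).

Definition finite_type : Prop :=
  exists (n : nat) (p : {lrmorphism {mpoly k[n]} -> A}),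
    forall a, exists x, p x = a.

Definition finitely_presented : Prop :=
  exists (n : nat) (p : {lrmorphism {mpoly k[n]} -> A}),
    (forall a, exists x, p x = a) /\
    exists (m : nat) (r : 'I_m -> {mpoly k[n]}), forall x,
      p x = 0 <-> exists c : 'I_m -> {mpoly k[n]}, x = \sum_j c j * r j.

Definition formally_smooth : Prop :=
  forall (C D : comAlgType k) (p : {lrmorphism C -> D}),
    (forall d, exists c, p c = d) ->
    (forall x y, p x = 0 -> p y = 0 -> x * y = 0) ->
    forall f : {lrmorphism A -> D},
      exists g : {lrmorphism A -> C}, forall a, p (g a) = f a.

(* Flatness follows from the other two conditions; it is listed because it is
   what makes Hochschild cohomology of a smooth group scheme meaningful. *)
Definition smooth_algebra : Prop :=
  [/\ flat_module A, finitely_presented & formally_smooth].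

End AlgebraProperties.

Section GModules.
Variables (k : comNzRingType) (G : affine_group k).

Definition flat_group : Prop := flat_module (coord_ring G).
Definition algebraic_group : Prop := finite_type (coord_ring G).
Definition smooth_group : Prop := smooth_algebra (coord_ring G).

Record gmodule := GModule {
  gcarrier :> lmodType k;
  coact : {linear gcarrier -> tensor gcarrier (coord_ring G)};
  coactA : forall v,
    tens_assoc (tens_map coact idfun (coact v))
      = tens_map idfun (comul G) (coact v);
  coact1 : forall v, tens_lift (fun u a => counit G a *: u) (coact v) = v
}.

Definition gequivariant (V W : gmodule) (f : V -> W) : Prop :=
  forall v, coact W (f v) = tens_map f idfun (coact V v).

Record ghom (V W : gmodule) := GHom {
  ghom_fun :> {linear V -> W};
  ghomP : gequivariant ghom_fun
}.

Section Invariants.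
Variable V : gmodule.

Definition ginvariant (v : V) : Prop := coact V v = v *t 1.

Definition invariantb : {pred V} := fun v => `[< ginvariant v >].

Lemma invariantP v : reflect (ginvariant v) (v \in invariantb).
Proof. exact: asboolP. Qed.

Lemma invariantb_submod : submod_closed invariantb.
Proof.
split=> [|a u v]; first by apply/invariantP; rewrite /ginvariant linear0 linear0l.
move=> /invariantP Hu /invariantP Hv; apply/invariantP.
by rewrite /ginvariant linearP Hu Hv linearPl.
Qed.

HB.instance Definition _ :=
  GRing.isSubmodClosed.Build k V invariantb invariantb_submod.

Record invariants := Invariants { inv_val : V; inv_valP : inv_val \in invariantb }.
HB.instance Definition _ := [isSub for inv_val].
HB.instance Definition _ := [Choice of invariants by <:].
HB.instance Definition _ := [SubChoice_isSubLmodule of invariants by <:].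

Definition inv_coact (v : invariants) : tensor invariants (coord_ring G) := v *t 1.

Lemma inv_coact_linear : linear inv_coact.
Proof. by move=> a u v; rewrite /inv_coact linearPl. Qed.

HB.instance Definition _ := GRing.isLinear.Build k invariants
  (tensor invariants (coord_ring G)) *:%R inv_coact inv_coact_linear.

Lemma inv_coactA v :
  tens_assoc (tens_map inv_coact idfun (inv_coact v))
    = tens_map idfun (comul G) (inv_coact v).
Proof.
rewrite [inv_coact v]/inv_coact !tens_map_pure /inv_coact /=.
by rewrite tens_assoc_pure comul1.
Qed.

Lemma inv_coact1 v : tens_lift (fun u a => counit G a *: u) (inv_coact v) = v.
Proof.
rewrite tens_lift_pure ?rmorph1 ?scale1r //.
split=> [b|u] c x y /=; first by rewrite scalerDr !scalerA mulrC.
by rewrite linearP scalerDl -scalerA.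
Qed.

(* V^G as a G-module. *)
Definition invmod : gmodule := GModule inv_coactA inv_coact1.

End Invariants.

Record reynolds (V : gmodule) := Reynolds {
  reynolds_fun :> ghom V (invmod V);
  reynolds_surj : forall w : invmod V, exists v, reynolds_fun v = w;
  reynolds_id : forall w : invmod V, reynolds_fun (inv_val w) = w
}.

Definition has_functorial_reynolds : Prop :=
  exists R : forall V : gmodule, reynolds V,
    forall (V W : gmodule) (f : ghom V W) (v : V),
      inv_val (R W (f v)) = f (inv_val (R V v)).

(* Over a flat G the monomorphisms of G-modules are the injective
   equivariant maps. *)
Definition injective_gmodule (I : gmodule) : Prop :=
  forall (V W : gmodule) (i : ghom V W) (f : ghom V I),
    injective i -> exists g : ghom W I, forall v, g (i v) = f v.

Record injective_resolution (V : gmodule) := InjectiveResolution {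
  res_obj : nat -> gmodule;
  res_diff : forall n, ghom (res_obj n) (res_obj n.+1);
  res_aug : ghom V (res_obj 0);
  res_injective : forall n, injective_gmodule (res_obj n);
  res_aug_inj : injective res_aug;
  res_exact0 : forall x, res_diff 0 x = 0 <-> exists v, res_aug v = x;
  res_exact : forall n x, res_diff n.+1 x = 0 <-> exists y, res_diff n y = x
}.

Definition cocycle (V : gmodule) (I : injective_resolution V) n
    (x : res_obj I n) : Prop :=
  ginvariant x /\ res_diff I n x = 0.

Definition coboundary (V : gmodule) (I : injective_resolution V) n :
    res_obj I n -> Prop :=
  match n return res_obj I n -> Prop with
  | 0 => fun x => x = 0
  | m.+1 => fun x => exists2 y : res_obj I m, ginvariant y & res_diff I m y = x
  end.

(* H^n(G, V) = 0, where H^n(G, V) is the n-th cohomology of the complex of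
   invariants of an injective resolution of V.  Such resolutions always exist,
   and the cohomology does not depend on the choice. *)
Definition cohomology_vanishes (n : nat) (V : gmodule) : Prop :=
  forall (I : injective_resolution V) (x : res_obj I n),
    cocycle x -> coboundary x.

Definition linearly_reductive : Prop :=
  flat_group /\ forall V : gmodule, cohomology_vanishes 1 V.

End GModules.

Section Dedekind.
Variable k : comNzRingType.

Definition integral_domain : Prop :=
  forall x y : k, x * y = 0 -> x = 0 \/ y = 0.

(* In MathComp [idealr_closed] describes proper ideals; the unit ideal is
   always finitely generated. *)
Definition noetherian_ring : Prop :=
  forall J : {pred k}, idealr_closed J ->
    exists (m : nat) (r : 'I_m -> k), forall x,
      x \in J <-> exists c : 'I_m -> k, x = \sum_j c j * r j.

(* A fraction a / b integral over k lies in k; the monic equation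
   (a / b)^n + \sum_(i < n) c_i (a / b)^i = 0 is multiplied by b^n. *)
Definition integrally_closed : Prop :=
  forall (a b : k) (n : nat) (c : 'I_n -> k), b != 0 ->
    a ^+ n + \sum_(i < n) c i * a ^+ i * b ^+ (n - i) = 0 ->
    exists d, a = d * b.

Definition nonzero_primes_maximal : Prop :=
  forall P J : {pred k}, idealr_closed P -> prime_idealr_closed P ->
    (exists2 x, x \in P & x != 0) ->
    idealr_closed J -> {subset P <= J} -> {subset J <= P}.

(* Fields are Dedekind domains under this convention. *)
Definition dedekind_domain : Prop :=
  [/\ integral_domain, noetherian_ring, integrally_closed &
      nonzero_primes_maximal].

End Dedekind.

(* Main.v *)
(* (a) If x = d y is an invariant 1-cocycle of an injective resolution and R is a
   functorial Reynolds operator, then x = R (d y) = d (R y) is a coboundary.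

   (b) Only flatness of A = k[G] and noetherianity of k are used.  Vanishing of
   H^1 makes invariants lift along equivariant maps.  For a G-module F that is
   finitely generated over k, the dual F^* is again a G-module, because F^* ⊗ A is
   the module of linear maps F -> A.  Applied to the evaluation F^* -> k at an
   invariant vector u, lifting produces an equivariant functional on F with value
   1 at u, provided some linear functional has value 1 there.  By local finiteness
   A is covered by finitely generated submodules F containing u = 1, where the
   counit is such a functional.  On invariants these functionals are determined by
   their value at 1, so by lifting of invariants again they agree on overlaps, and
   they glue to an integral mu : A -> k which is invariant on one side with
   mu 1 = 1.  Composing mu with the antipode gives an integral on the other side,
   hence mu is two-sided invariant, and v |-> (id ⊗ mu) (coact v) is the Reynolds
   operator. *)
Require Import Defs.
From HB Require Import structures.
From mathcomp Require Import all_boot all_order all_algebra.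
From mathcomp Require Import generic_quotient ring_quotient sesquilinear.
From mathcomp Require Import boolp classical_sets functions.

Set Implicit Arguments.
Unset Strict Implicit.
Unset Printing Implicit Defensive.

Import Order.TTheory GRing.Theory Num.Theory.
Local Open Scope ring_scope.

(** * Tensor calculus *)

Section Sweedler.
Variable k : comNzRingType.
Implicit Types U V W X Z : lmodType k.

Definition lin_of U V (f : U -> V) (f_lin : linear f) : {linear U -> V} :=
  HB.pack f (GRing.isLinear.Build k U V *:%R f f_lin).

Definition bilin U V W (b : U -> V -> W) := bilinear_for *:%R *:%R b.

Lemma tens_eq U V W (f g : tensor V W -> U) : linear f -> linear g ->
  (forall v w, f (v *t w) = g (v *t w)) -> f =1 g.
Proof. by move=> fl gl fg; apply: (@tens_ext _ _ _ _ (lin_of fl) (lin_of gl)). Qed.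

Lemma linear_lift U U' V W (h : {linear U -> U'}) (b : V -> W -> U) t :
  h (tens_lift b t) = tens_lift (fun v w => h (b v w)) t.
Proof. exact: linear_sum. Qed.

Lemma eq_lift U V W (b c : V -> W -> U) : (forall v w, b v w = c v w) ->
  tens_lift b =1 tens_lift c.
Proof. by move=> bc t; apply: eq_bigr. Qed.

Lemma lift_pure V W (t : tensor V W) : tens_lift (fun v w => v *t w) t = t.
Proof. by rewrite [RHS]tens_sum_repr. Qed.

Lemma lift_map U V W V' W' (b : V' -> W' -> U) (f : {linear V -> V'})
    (g : {linear W -> W'}) t : bilin b ->
  tens_lift b (tens_map f g t) = tens_lift (fun v w => b (f v) (g w)) t.
Proof.
move=> bb; rewrite [tens_map f g t]/tens_map.
rewrite -[tens_lift b]/(lin_of (tens_lift_linear bb) : _ -> _) linear_lift.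
by apply: eq_lift => v w /=; apply: tens_lift_pure.
Qed.

Lemma lift_lift U V W V' W' (b : V' -> W' -> U)
    (c : V -> W -> tensor V' W') t : bilin b ->
  tens_lift b (tens_lift c t) = tens_lift (fun v w => tens_lift b (c v w)) t.
Proof. by move=> bb; rewrite -(linear_lift (lin_of (tens_lift_linear bb))). Qed.

Lemma lift_param U V W Z (b : Z -> V -> W -> U) t :
  (forall v w, linear (fun z => b z v w)) -> linear (fun z => tens_lift (b z) t).
Proof.
move=> bl a x y; rewrite /tens_lift scaler_sumr -big_split /=.
by apply: eq_bigr => p _; apply: bl.
Qed.

Lemma linear_comp U V W (f : V -> W) (g : U -> V) :
  linear f -> linear g -> linear (fun x => f (g x)).
Proof. by move=> fl gl a x y; rewrite gl fl. Qed.

Lemma pure_linl U V (v : V) : linear (fun u : U => u *t v).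
Proof. by move=> a x y; rewrite linearPl. Qed.

Lemma pure_linr U V (u : U) : linear (fun v : V => u *t v).
Proof. by move=> a x y; rewrite linearPr. Qed.

Lemma tens_map_comp V W V' W' V'' W'' (f : {linear V -> V'}) (g : {linear W -> W'})
    (f' : {linear V' -> V''}) (g' : {linear W' -> W''}) (t : tensor V W) :
  tens_map f' g' (tens_map f g t) = tens_map (f' \o f) (g' \o g) t.
Proof. by apply: lift_map; apply: tens_map_bilinear. Qed.

Lemma tens_map_id V W (t : tensor V W) : tens_map idfun idfun t = t.
Proof. exact: lift_pure. Qed.

Lemma eq_tens_map V W V' W' (f f' : V -> V') (g g' : W -> W') :
  f =1 f' -> g =1 g' -> tens_map f g =1 tens_map f' g'.
Proof. by move=> ff gg; apply: eq_lift => v w; rewrite ff gg. Qed.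

Lemma functional_bilinl U V W (f : {linear V -> k^o}) (g : {linear W -> U}) :
  bilin (fun v w => (f v : k) *: g w).
Proof.
split=> [w|v] c x y /=; last by rewrite linearP scalerDr !scalerA mulrC.
by rewrite linearP scalerDl -[(_ *: _ : k^o)]/(c * _) -scalerA.
Qed.

Lemma functional_bilinr U V W (f : {linear W -> k^o}) (g : {linear V -> U}) :
  bilin (fun v w => (f w : k) *: g v).
Proof. by have [fgl fgr] := functional_bilinl f g; split=> [w|v]. Qed.

Definition tens_unassoc U V W : tensor U (tensor V W) -> tensor (tensor U V) W :=
  tens_lift (fun u => tens_lift (fun v w => u *t v *t w)).

Lemma unassoc_bilinear1 U V W (u : U) :
  bilin (fun (v : V) (w : W) => u *t v *t w).
Proof. by split=> [w|v] a x y; rewrite ?linearPr ?linearPl. Qed.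

Lemma unassoc_bilinear U V W :
  bilin (fun (u : U) => tens_lift (fun (v : V) (w : W) => u *t v *t w)).
Proof.
split=> [t|u]; last exact: tens_lift_linear (unassoc_bilinear1 _ _ _).
by apply: lift_param => v w a x y; rewrite !linearPl.
Qed.

HB.instance Definition _ U V W :=
  GRing.isLinear.Build k (tensor U (tensor V W)) (tensor (tensor U V) W) *:%R
    (@tens_unassoc U V W) (tens_lift_linear (unassoc_bilinear U V W)).

Lemma unassoc_pure U V W (u : U) (v : V) (w : W) :
  tens_unassoc (u *t (v *t w)) = u *t v *t w.
Proof.
rewrite /tens_unassoc (tens_lift_pure (unassoc_bilinear _ _ _)).
by rewrite (tens_lift_pure (unassoc_bilinear1 _ _ _)).
Qed.

Lemma linear_eq3l U V W X (f g : {linear tensor (tensor U V) W -> X}) :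
  (forall u v w, f (u *t v *t w) = g (u *t v *t w)) -> f =1 g.
Proof.
move=> fg; apply: tens_ext => t w; move: t.
apply: tens_eq => [||u v]; last exact: fg.
  exact: linear_comp (linearP f) (pure_linl w).
exact: linear_comp (linearP g) (pure_linl w).
Qed.

Lemma linear_eq3r U V W X (f g : {linear tensor U (tensor V W) -> X}) :
  (forall u v w, f (u *t (v *t w)) = g (u *t (v *t w))) -> f =1 g.
Proof.
move=> fg; apply: tens_ext => u; apply: tens_eq => [||v w]; last exact: fg.
  exact: linear_comp (linearP f) (pure_linr u).
exact: linear_comp (linearP g) (pure_linr u).
Qed.

Lemma assocK U V W : cancel (@tens_assoc k U V W) (@tens_unassoc U V W).
Proof.
apply: (@linear_eq3l _ _ _ _ (@tens_unassoc U V W \o @tens_assoc k U V W) idfun).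
by move=> u v w /=; rewrite tens_assoc_pure unassoc_pure.
Qed.

Lemma unassocK U V W : cancel (@tens_unassoc U V W) (@tens_assoc k U V W).
Proof.
apply: (@linear_eq3r _ _ _ _ (@tens_assoc k U V W \o @tens_unassoc U V W) idfun).
by move=> u v w /=; rewrite unassoc_pure tens_assoc_pure.
Qed.

Lemma assoc_map U V W U' V' W' (f : {linear U -> U'}) (g : {linear V -> V'})
    (h : {linear W -> W'}) t :
  tens_assoc (tens_map (tens_map f g) h t) =
  tens_map f (tens_map g h) (tens_assoc t).
Proof.
apply: (@linear_eq3l _ _ _ _
  (@tens_assoc k U' V' W' \o tens_map (tens_map f g) h)
  (tens_map f (tens_map g h) \o @tens_assoc k U V W)) t => u v w /=.
rewrite !tens_map_pure /= tens_map_pure !tens_assoc_pure tens_map_pure /=.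
by rewrite tens_map_pure.
Qed.

(** Up to associativity, tensoring [f] with [M ⊗ N] is tensoring it first with [M] and then with
    [N]. *)
Lemma flat_tensor (M N : lmodType k) :
  flat_module M -> flat_module N -> flat_module (tensor M N).
Proof.
move=> Mf Nf V W f f_inj x y exy.
apply: (can_inj (@unassocK V M N)); apply: (Nf _ _ _ (Mf _ _ _ f_inj)).
apply: (can_inj (@assocK W M N)); rewrite !assoc_map !unassocK.
have E : tens_map f (tens_map idfun (@idfun N)) =1 tens_map f (@idfun (tensor M N)).
  by apply: eq_tens_map => // t; exact: tens_map_id.
by rewrite !E.
Qed.

End Sweedler.

(** * Submodules, quotients and exactness of the tensor product *)

Section SubQuotient.
Variables (k : comNzRingType) (V : lmodType k) (P : V -> Prop).

Definition submodule := P 0 /\ forall a u v, P u -> P v -> P (a *: u + v).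

Hypothesis P_sub : submodule.

Definition in_sub of submodule : {pred V} := fun v => `[< P v >].

Lemma in_subP v : reflect (P v) (v \in in_sub P_sub).
Proof. exact: asboolP. Qed.

Lemma in_sub_closed : submod_closed (in_sub P_sub).
Proof.
split=> [|a u v]; first by apply/in_subP; case: P_sub.
by move=> /in_subP Pu /in_subP Pv; apply/in_subP; case: P_sub => _; apply.
Qed.

HB.instance Definition _ := GRing.isSubmodClosed.Build k V (in_sub P_sub) in_sub_closed.

Record submod := Submod { sub_val : V; sub_valP : sub_val \in in_sub P_sub }.
HB.instance Definition _ := [isSub for sub_val].
HB.instance Definition _ := [Choice of submod by <:].
HB.instance Definition _ := [SubChoice_isSubLmodule of submod by <:].

Definition sub_incl : {linear submod -> V} := val.

Lemma sub_incl_inj : injective sub_incl.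
Proof. exact: val_inj. Qed.

Lemma sub_inclP x : P (sub_incl x).
Proof. exact/in_subP/sub_valP. Qed.

Lemma sub_incl_onto v : P v -> exists x, sub_incl x = v.
Proof. by move=> /in_subP Pv; exists (Submod Pv). Qed.

Let sub_zmod : zmodClosed V := GRing.ZmodClosed.clone V (in_sub P_sub) _.

Definition quotmod : Type := Quotient.quot sub_zmod.
HB.instance Definition _ := GRing.Zmodule.on quotmod.

Definition quot_pi (v : V) : quotmod := \pi_(Quotient.quot sub_zmod)%qT v.

Lemma quot_pi_eq u v : quot_pi u = quot_pi v <-> P (u - v).
Proof.
rewrite /quot_pi; split=> [/eqP|/in_subP uv]; first by rewrite piE => /in_subP.
by apply/eqP; rewrite piE.
Qed.

Lemma quot_pi_onto x : exists v, quot_pi v = x.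
Proof. by exists (repr (x : Quotient.quot sub_zmod)); rewrite /quot_pi reprK. Qed.

Lemma quot_piD u v : quot_pi (u + v) = quot_pi u + quot_pi v.
Proof. by rewrite /quot_pi raddfD. Qed.

Definition quot_scale a (x : quotmod) : quotmod :=
  quot_pi (a *: repr (x : Quotient.quot sub_zmod)).

Lemma quot_scaleE a v : quot_scale a (quot_pi v) = quot_pi (a *: v).
Proof.
apply/quot_pi_eq; rewrite -scalerBr -[_ *: _]addr0; case: (P_sub) => P0 Pl.
by apply: Pl => //; apply/quot_pi_eq; rewrite /quot_pi reprK.
Qed.

Lemma quot_scaleA a b x : quot_scale a (quot_scale b x) = quot_scale (a * b) x.
Proof. by have [v <-] := quot_pi_onto x; rewrite !quot_scaleE scalerA. Qed.

Lemma quot_scale1 : left_id 1 quot_scale.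
Proof. by move=> x; have [v <-] := quot_pi_onto x; rewrite quot_scaleE scale1r. Qed.

Lemma quot_scaleDr : right_distributive quot_scale +%R.
Proof.
move=> a x y; have [u <-] := quot_pi_onto x; have [v <-] := quot_pi_onto y.
by rewrite -quot_piD !quot_scaleE scalerDr quot_piD.
Qed.

Lemma quot_scaleDl x : {morph quot_scale^~ x : a b / a + b}.
Proof.
by move=> a b; have [u <-] := quot_pi_onto x; rewrite !quot_scaleE scalerDl quot_piD.
Qed.

HB.instance Definition _ := GRing.Zmodule_isLmodule.Build k quotmod
  quot_scaleA quot_scale1 quot_scaleDr quot_scaleDl.

Lemma quot_pi_linear : linear quot_pi.
Proof. by move=> a u v; rewrite quot_piD -quot_scaleE. Qed.

HB.instance Definition _ := GRing.isLinear.Build k V quotmod *:%R quot_pi quot_pi_linear.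

Lemma quot_pi0 v : quot_pi v = 0 <-> P v.
Proof. by rewrite -(linear0 quot_pi) quot_pi_eq subr0. Qed.

End SubQuotient.

(** * Kernels and flat tensor products *)

Section Exactness.
Variable k : comNzRingType.
Implicit Types U V W M : lmodType k.

Lemma ker_submodule V W (f : {linear V -> W}) : submodule (fun v => f v = 0).
Proof.
split=> [|a u v fu fv]; first exact: linear0.
by rewrite linearP fu fv scaler0 addr0.
Qed.

Definition ker V W (f : {linear V -> W}) : lmodType k := submod (ker_submodule f).
Definition ker_incl V W (f : {linear V -> W}) : {linear ker f -> V} :=
  sub_incl (ker_submodule f).

(* The kernel of [f ⊗ M] for surjective [f] is the image [I] of [ker f ⊗ M]:
   lifting along [f] gives an inverse of (V ⊗ M) / I -> W ⊗ M. *)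
Lemma tens_ker_surj V W M (f : {linear V -> W}) (t : tensor V M) :
  (forall w, exists v, f v = w) -> tens_map f (@idfun M) t = 0 ->
  exists t', tens_map (ker_incl f) (@idfun M) t' = t.
Proof.
move=> f_onto t0; pose g w := sval (cid (f_onto w)).
have gK w : f (g w) = w by rewrite /g; case: cid.
have Isub : submodule (fun t => exists t', tens_map (ker_incl f) (@idfun M) t' = t).
  split=> [|a _ _ [x <-] [y <-]]; first by exists 0; rewrite linear0.
  by exists (a *: x + y); rewrite linearP.
apply/(quot_pi0 Isub).
(* Preimages of [w] differ by elements of [ker f], so modulo [I] the choice made by [g] is
   immaterial. This makes the map below bilinear although [g] itself is only a map of sets. *)
have gE v w m : f v = w -> quot_pi Isub (g w *t m) = quot_pi Isub (v *t m).
  move=> fv; apply/quot_pi_eq; rewrite -linearBl.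
  have [|x xE] := @sub_incl_onto _ _ _ (ker_submodule f) (g w - v).
    by rewrite linearB gK fv subrr.
  by exists (x *t m); rewrite tens_map_pure xE.
have bb : bilin (fun w m => quot_pi Isub (g w *t m)).
  split=> [m|w] a x y /=; last by rewrite linearPr linearP.
  rewrite (gE (a *: g x + g y)) ?linearP ?gK //=.
  by rewrite linearPl linearP.
rewrite -[RHS](linear0 (lin_of (tens_lift_linear bb))) -t0.
rewrite [RHS](@lift_map _ _ _ _ _ _ _ f idfun) //=.
rewrite -[in LHS](lift_pure t) linear_lift; apply: eq_lift => v m.
by rewrite (gE v).
Qed.

(** [f] induces an injection of [V / ker f] into [W], which stays injective after tensoring with the
    flat [M]. Hence [t] dies already in [(V / ker f) ⊗ M], and the surjective case applies. *)
Lemma tens_ker V W M (f : {linear V -> W}) (t : tensor V M) :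
  flat_module M -> tens_map f (@idfun M) t = 0 ->
  exists t', tens_map (ker_incl f) (@idfun M) t' = t.
Proof.
move=> Mf t0; pose Q := quotmod (ker_submodule f).
pose q : {linear V -> Q} := quot_pi (ker_submodule f).
have q_onto x : exists v, q v = x by apply: quot_pi_onto.
pose h (x : Q) := f (sval (cid (q_onto x))).
have hE v : h (q v) = f v.
  rewrite /h; case: cid => u /= /quot_pi_eq; rewrite linearB => /eqP.
  by rewrite subr_eq0 => /eqP.
have hl : linear h.
  move=> a x y; have [u <-] := q_onto x; have [v <-] := q_onto y.
  by rewrite -linearP !hE linearP.
have h_inj : injective (lin_of hl).
  move=> x y; have [u <-] := q_onto x; have [v <-] := q_onto y.
  rewrite /= !hE => uv; apply/quot_pi_eq; by rewrite linearB uv subrr.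
have qt0 : tens_map q (@idfun M) t = 0.
  apply: (Mf _ _ _ h_inj); rewrite tens_map_comp linear0 -[RHS]t0.
  by apply: eq_tens_map => // v; apply: hE.
have [t' tE] := tens_ker_surj q_onto qt0.
have kE x : f (ker_incl q x) = 0.
  by rewrite -hE (sub_inclP x : q (ker_incl q x) = 0) -[h]/(lin_of hl : _ -> _) linear0.
pose j x : ker f := Submod (introT (in_subP (ker_submodule f) _) (kE x)).
have jl : linear j by move=> a x y; apply: val_inj; rewrite !linearP.
exists (tens_map (lin_of jl) idfun t'); rewrite tens_map_comp -tE.
by apply: eq_tens_map.
Qed.

End Exactness.

(** * Constructions of G-modules *)

Section Comodules.
Variables (k : comNzRingType) (G : affine_group k).
Notation A := (coord_ring G).
Implicit Types (U Z M N : lmodType k) (V W : gmodule G).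

Lemma counit_bilin U : bilin (fun (u : U) (a : A) => counit G a *: u).
Proof.
split=> [a|u] c x y /=; first by rewrite scalerDr !scalerA mulrC.
by rewrite linearP /= scalerDl -scalerA.
Qed.

Definition counit_lift U : tensor U A -> U := tens_lift (fun u a => counit G a *: u).
HB.instance Definition _ U := GRing.isLinear.Build k (tensor U A) U *:%R
  (@counit_lift U) (tens_lift_linear (counit_bilin U)).

Lemma counit_lift_map U Z (f : {linear U -> Z}) t :
  counit_lift (tens_map f idfun t) = f (counit_lift t).
Proof.
rewrite [LHS](lift_map _ idfun) ?linear_lift; last exact: counit_bilin.
by apply: eq_lift => u a /=; rewrite linearZ.
Qed.

Lemma coactK V v : counit_lift (coact V v) = v.
Proof. exact: coact1. Qed.

(** Coassociativity in Sweedler form: to apply a trilinear [T] to [v_0 ⊗ v_1 ⊗ v_2], one may coact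
    twice or comultiply once. For [V] = [regular] it is coassociativity of [A] itself. *)
Lemma coassoc_lift V U (T : V -> A -> A -> U) :
  (forall a b, linear (fun v => T v a b)) -> (forall v b, linear (T v ^~ b)) ->
  (forall v a, linear (T v a)) -> forall v,
  tens_lift (fun u b => tens_lift (fun u' a => T u' a b) (coact V u)) (coact V v) =
  tens_lift (fun u b => tens_lift (T u) (comul G b)) (coact V v).
Proof.
move=> T1 T2 T3 v.
have b1 u : bilin (T u) by split.
have b2 : bilin (fun u => tens_lift (T u)).
  split=> [t|u]; last exact: tens_lift_linear (b1 u).
  exact: lift_param.
have b3 b : bilin (fun u a => T u a b) by split.
transitivity (tens_lift (fun u => tens_lift (T u))
  (tens_map idfun (comul G) (coact V v))); last by rewrite lift_map.
rewrite -coactA [in RHS]/tens_assoc lift_lift // [RHS]lift_map; last first.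
  split=> [b|t] /=; first exact: linear_comp (tens_lift_linear b2)
                         (tens_lift_linear (tens_assoc_bilinear1 _ _ b)).
  apply: linear_comp (tens_lift_linear b2) _.
  by apply: lift_param => u a; apply: linear_comp (pure_linr u) (pure_linr a).
apply: eq_lift => u b; rewrite lift_lift //=; apply: eq_lift => u' a.
by rewrite (tens_lift_pure b2) (tens_lift_pure (b1 _)).
Qed.

Lemma assoc_mapl U Z (f : {linear U -> Z}) (t : tensor (tensor U A) A) :
  tens_assoc (tens_map (tens_map f (@idfun A)) (@idfun A) t) =
  tens_map f (@idfun (tensor A A)) (tens_assoc t).
Proof. by rewrite assoc_map; apply: eq_lift => u s /=; rewrite tens_map_id. Qed.

Lemma tens_map_swap U Z M N (f : {linear U -> Z}) (g : {linear M -> N}) t :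
  tens_map idfun g (tens_map f idfun t) = tens_map f idfun (tens_map idfun g t).
Proof. by rewrite !tens_map_comp; apply: eq_tens_map. Qed.

(** Coassociativity passes to images of G-modules under maps compatible with the coactions. Cofree
    modules, direct sums and quotients are spanned by such images. *)
Lemma coactA_image V Z (rho : {linear Z -> tensor Z A}) (j : {linear V -> Z}) v :
  (forall v, rho (j v) = tens_map j idfun (coact V v)) ->
  tens_assoc (tens_map rho idfun (rho (j v))) = tens_map idfun (comul G) (rho (j v)).
Proof.
move=> rhoj; rewrite rhoj tens_map_swap -coactA -assoc_mapl !tens_map_comp.
by congr tens_assoc; apply: eq_tens_map.
Qed.

Lemma coact1_image V Z (rho : {linear Z -> tensor Z A}) (j : {linear V -> Z}) v :
  (forall v, rho (j v) = tens_map j idfun (coact V v)) ->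
  counit_lift (rho (j v)) = j v.
Proof. by move=> ->; rewrite counit_lift_map coactK. Qed.

Definition regular : gmodule G := GModule (@comulA k G) (@counitr k G).

(** * Cofree comodules *)

Section Cofree.
Variable U : lmodType k.

Definition cofree_coact : tensor U A -> tensor (tensor U A) A :=
  @tens_unassoc k U A A \o tens_map idfun (comul G).
HB.instance Definition _ := GRing.Linear.on cofree_coact.

Definition pure_map (u : U) : {linear A -> tensor U A} := lin_of (pure_linr u).

(** For fixed [u], the map [a |-> u ⊗ a] is equivariant from [regular], which reduces the axioms for
    [U ⊗ A] to those for [A]. *)
Lemma cofree_coact_pure (u : U) (a : A) :
  cofree_coact (pure_map u a) = tens_map (pure_map u) idfun (coact regular a).
Proof.
rewrite /cofree_coact /= tens_map_pure /=; move: (comul G a).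
by rewrite /tens_unassoc => t; rewrite (tens_lift_pure (unassoc_bilinear _ _ _)).
Qed.

Lemma cofree_coactA t :
  tens_assoc (tens_map cofree_coact idfun (cofree_coact t)) =
  tens_map idfun (comul G) (cofree_coact t).
Proof.
apply: (@tens_ext _ _ _ _
  (@tens_assoc k _ _ _ \o (tens_map cofree_coact idfun \o cofree_coact))
  (tens_map idfun (comul G) \o cofree_coact)) t => u a.
exact: (@coactA_image regular _ cofree_coact (pure_map u)) (cofree_coact_pure u).
Qed.

Lemma cofree_coact1 t : counit_lift (cofree_coact t) = t.
Proof.
apply: (@tens_ext _ _ _ _ (@counit_lift _ \o cofree_coact) idfun) t => u a.
exact: (@coact1_image regular _ cofree_coact (pure_map u)) (cofree_coact_pure u).
Qed.

Definition cofree : gmodule G := GModule cofree_coactA cofree_coact1.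

End Cofree.

Section Trivial.
Variable U : lmodType k.

Definition triv_coact : {linear U -> tensor U A} := lin_of (pure_linl (1 : A)).

Lemma triv_coactA u :
  tens_assoc (tens_map triv_coact idfun (triv_coact u)) =
  tens_map idfun (comul G) (triv_coact u).
Proof.
have E x : triv_coact x = x *t 1 by [].
by rewrite E !tens_map_pure E tens_assoc_pure comul1.
Qed.

Lemma triv_coact1 u : counit_lift (triv_coact u) = u.
Proof.
by rewrite /counit_lift (tens_lift_pure (counit_bilin _)) rmorph1 scale1r.
Qed.

Definition trivial : gmodule G := GModule triv_coactA triv_coact1.

End Trivial.

Section Product.
Variables V W : gmodule G.

Lemma inl_linear : linear (fun v : V => (v, 0 : W)).
Proof. by move=> a x y; congr pair; rewrite /= scaler0 addr0. Qed.

Lemma inr_linear : linear (fun w : W => (0 : V, w)).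
Proof. by move=> a x y; congr pair; rewrite /= scaler0 addr0. Qed.

Definition prod_inl := lin_of inl_linear.
Definition prod_inr := lin_of inr_linear.

Definition prod_coact (x : V * W) : tensor (V * W)%type A :=
  tens_map prod_inl idfun (coact V x.1) + tens_map prod_inr idfun (coact W x.2).

Lemma prod_coact_linear : linear prod_coact.
Proof.
by move=> a x y; rewrite /prod_coact !linearP /= scalerDr addrACA.
Qed.
HB.instance Definition _ := GRing.isLinear.Build k (V * W)%type
  (tensor (V * W)%type A) *:%R prod_coact prod_coact_linear.

Lemma prod_coact_inl v : prod_coact (prod_inl v) = tens_map prod_inl idfun (coact V v).
Proof. by rewrite /prod_coact (_ : (prod_inl v).2 = 0) // !linear0 addr0. Qed.

Lemma prod_coact_inr w : prod_coact (prod_inr w) = tens_map prod_inr idfun (coact W w).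
Proof. by rewrite /prod_coact (_ : (prod_inr w).1 = 0) // !linear0 add0r. Qed.

Lemma prod_inlr (x : V * W) : x = prod_inl x.1 + prod_inr x.2.
Proof. by case: x => x y; congr pair; rewrite /= ?addr0 ?add0r. Qed.

Lemma prod_eq U (f g : {linear (V * W)%type -> U}) :
  (forall v, f (prod_inl v) = g (prod_inl v)) ->
  (forall w, f (prod_inr w) = g (prod_inr w)) -> f =1 g.
Proof.
move=> fgl fgr x; rewrite (prod_inlr x).
by rewrite (linearD f) (linearD g) fgl fgr.
Qed.

Lemma prod_coactA x :
  tens_assoc (tens_map prod_coact idfun (prod_coact x)) =
  tens_map idfun (comul G) (prod_coact x).
Proof.
apply: (@prod_eq _ (@tens_assoc k _ _ _ \o (tens_map prod_coact idfun \o prod_coact))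
  (tens_map idfun (comul G) \o prod_coact)) x => [v|w].
  exact: coactA_image prod_coact_inl.
exact: coactA_image prod_coact_inr.
Qed.

Lemma prod_coact1 x : counit_lift (prod_coact x) = x.
Proof.
apply: (@prod_eq _ (@counit_lift _ \o prod_coact) idfun) x => [v|w].
  exact: coact1_image prod_coact_inl.
exact: coact1_image prod_coact_inr.
Qed.

Definition gprod : gmodule G := GModule prod_coactA prod_coact1.

End Product.

Section Quotient.
Variables (W : gmodule G) (Z : lmodType k) (p : {linear W -> Z}).
Variable rho : {linear Z -> tensor Z A}.
Hypothesis p_onto : forall z, exists w, p w = z.
Hypothesis rhoE : forall w, rho (p w) = tens_map p idfun (coact W w).

Lemma quot_coactA z :
  tens_assoc (tens_map rho idfun (rho z)) = tens_map idfun (comul G) (rho z).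
Proof. by have [w <-] := p_onto z; apply: coactA_image. Qed.

Lemma quot_coact1 z : counit_lift (rho z) = z.
Proof. by have [w <-] := p_onto z; apply: coact1_image. Qed.

Definition gquot : gmodule G := GModule quot_coactA quot_coact1.

End Quotient.

(** * Stable submodules *)

Section Sub.
Variables (W : gmodule G) (Z : lmodType k) (i : {linear Z -> W}).
Hypothesis A_flat : flat_module A.
Hypothesis i_inj : injective i.
Hypothesis i_stable : forall z, exists t, tens_map i (@idfun A) t = coact W (i z).

(** Flatness keeps [i ⊗ A] injective, so the chosen preimage is the only one. Linearity follows from
    this uniqueness, and coassociativity from its analogue for [A ⊗ A]. *)
Definition sub_coact z := sval (cid (i_stable z)).

Lemma sub_coactE z : tens_map i idfun (sub_coact z) = coact W (i z).
Proof. exact: svalP (cid (i_stable z)). Qed.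

Lemma sub_coact_linear : linear sub_coact.
Proof.
move=> a x y; apply: (A_flat i_inj).
by rewrite linearP /= !sub_coactE !linearP.
Qed.
HB.instance Definition _ := GRing.isLinear.Build k Z (tensor Z A) *:%R
  sub_coact sub_coact_linear.

Lemma sub_coactA z :
  tens_assoc (tens_map sub_coact idfun (sub_coact z)) =
  tens_map idfun (comul G) (sub_coact z).
Proof.
apply: (flat_tensor A_flat A_flat i_inj).
rewrite -assoc_mapl -tens_map_swap sub_coactE -coactA -sub_coactE !tens_map_comp.
by congr tens_assoc; apply: eq_tens_map => // x; apply: sub_coactE.
Qed.

Lemma sub_coact1 z : counit_lift (sub_coact z) = z.
Proof. by apply: i_inj; rewrite -counit_lift_map sub_coactE coactK. Qed.

Definition gsub : gmodule G := GModule sub_coactA sub_coact1.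

Lemma gsub_incl_equivariant : @gequivariant k G gsub W i.
Proof. by move=> z; rewrite -sub_coactE. Qed.

Definition gsub_incl : ghom gsub W := GHom gsub_incl_equivariant.

End Sub.

End Comodules.

(** * Divisible abelian groups *)

Section DivisibleGroups.

(** The generator [d] is the least positive element of [I], since remainders modulo [d] stay in [I].
    If there is no positive element, [I] is zero and [d = 0]. *)
Lemma int_subgroup (I : int -> Prop) : I 0 -> (forall m n, I m -> I n -> I (m - n)) ->
  exists d : nat, forall n, I n <-> (d%:Z %| n)%Z.
Proof.
move=> I0 IB.
have IN n : I n -> I (- n) by move=> In; rewrite -sub0r; apply: IB.
have ID m n : I m -> I n -> I (m + n).
  by move=> Im In; rewrite -[n]opprK; apply/IB/IN.
have IM (m : int) n : I n -> I (m * n).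
  move=> In; have IMn (p : nat) : I (p%:Z * n).
    elim: p => [|p IHp]; first by rewrite mul0r.
    by rewrite intS mulrDl mul1r; apply: ID.
  by case: m => p //; rewrite NegzE mulNr; apply/IN/IMn.
pose Ipos (p : nat) := (0 < p)%N && `[< I p%:Z >].
have [exP|noP] := pselect (exists p, Ipos p).
  case: (ex_minnP exP) => d /andP[d_gt0 /asboolP Id] d_min.
  exists d => n; split=> [In|/dvdzP[q ->]]; last exact: IM.
  have d_neq0 : d%:Z != 0 :> int by rewrite eqz_nat -lt0n.
  have : I (n %% d%:Z)%Z by apply: IB => //; apply: IM.
  have := ltz_pmod n (d_gt0 : 0 < d%:Z).
  have := modz_ge0 n d_neq0; rewrite /dvdz; case E : (n %% d)%Z => [[|r]|//] _.
    by move=> _ _; apply/dvdz_mod0P.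
  move=> rd Ir; have := d_min r.+1; rewrite /Ipos /= => /(_ (introT (asboolP _) Ir)).
  by rewrite leqNgt => /negP[].
exists 0%N => n; rewrite dvd0z; split=> [In|/eqP -> //].
have [//|n0] := eqVneq n 0; case: noP; exists `|n|%N.
rewrite /Ipos absz_gt0 n0; apply/asboolP.
by case: n In {n0} => p // /IN; rewrite NegzE opprK.
Qed.

Definition divisible (D : zmodType) := forall (d : nat) (x : D), (0 < d)%N ->
  exists y, y *+ d = x.

(** The graph of a homomorphism to [D] from a subgroup of [M], or the empty set. For a set closed
    under subtraction, being single-valued need only be required at 0. *)
Definition partial_morphism (M D : zmodType) (S : set (M * D)) :=
  (forall p q, S p -> S q -> S (p - q)) /\ (forall d, S (0, d) -> d = 0).

Section Extension.
Variables M D : zmodType.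
Hypothesis D_div : divisible D.
Implicit Type S : set (M * D).

Lemma partial_morphismMz S p (n : int) : partial_morphism S -> S p -> S (p *~ n).
Proof.
move=> [SB _] Sp; have S0 : S 0 by rewrite -(subrr p); apply: SB.
have SN q : S q -> S (- q) by move=> Sq; rewrite -sub0r; apply: SB.
have SMn (m : nat) : S (p *~ m).
  elim: m => [//|m IHm]; rewrite intS mulrzDr addrC -[p *~ 1]opprK.
  exact/SB/SN.
by case: n => m //; rewrite NegzE mulrNz; apply/SN/SMn.
Qed.

(** The multiples of [m] in the domain are those by multiples of some [c]. Divisibility gives [e]
    with [c e] equal to the value at [c m], and sending [m] to [e] would extend a maximal [S]. *)
Lemma partial_morphism_total S :
  S (0, 0) -> partial_morphism S -> (forall S', (S `<` S')%classic ->
    ~ (S' (0, 0) /\ partial_morphism S')) ->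
  forall m, exists d, S (m, d).
Proof.
move=> S0 pS Smax m; have [SB Sfun] := pS; apply: contrapT => Sm.
have SD p q : S p -> S q -> S (p + q).
  by move=> Sp Sq; rewrite -[q]opprK; apply: (SB) => //; rewrite -sub0r; apply: SB.
have [c cP] : exists c : nat, forall n : int, (exists d, S (m *~ n, d)) <-> (c%:Z %| n)%Z.
  apply: int_subgroup => [|i j [d Sd] [e Se]]; first by exists 0.
  by exists (d - e); rewrite mulrzBr; apply: (SB _ _ Sd Se).
have [d Sd] : exists d, S (m *~ c%:Z, d) by apply/cP.
have [e eE] : exists e, e *~ c%:Z = d.
  case: (posnP c) Sd => [->|c_gt0] Sd; first by exists 0; rewrite (Sfun d).
  exact: D_div.
pose S' : set (M * D) := fun p => exists (q : M * D) (n : int), S q /\ p = q + (m, e) *~ n.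
apply: (Smax S'); last split.
- split=> [p Sp|S'S]; first by exists p, 0; split=> //; rewrite addr0.
  by apply: Sm; exists e; apply: S'S; exists 0, 1; split=> //; rewrite add0r.
- by exists 0, 0; split=> //; rewrite addr0.
split=> [_ _ [p [i [Sp ->]]] [q [j [Sq ->]]]|x [[q1 q2] [n [Sq]]]].
  exists (p - q), (i - j); split; first exact: SB.
  by rewrite mulrzBr addrACA opprD.
have pairMz (a : M) (b : D) (j : int) : (a, b) *~ j = (a *~ j, b *~ j).
  have pairMn (l : nat) : (a, b) *+ l = (a *+ l, b *+ l).
    by elim: l => // l IHl; rewrite !mulrS IHl.
  by case: j => l; rewrite ?NegzE ?mulrNz -!pmulrn pairMn.
rewrite pairMz => -[/esym q1E ->].
(* Here [q + n (m, e)] has first component 0, so [- n m] lies in the domain, [c] divides [n], and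
   the value of [S] at [- n m] is [- n e]. *)
have q1N : q1 = m *~ (- n) by apply/eqP; rewrite mulrNz -addr_eq0 q1E.
have /dvdzP[l nl] : (c%:Z %| - n)%Z by apply/cP; exists q2; rewrite -q1N.
have := partial_morphismMz l pS Sd; rewrite pairMz -mulrzA mulrC -nl -q1N => Sl.
have : S ((q1, q2) - (q1, d *~ l)) by apply: SB.
rewrite (_ : _ - _ = (0, q2 - d *~ l)); last by apply: injective_projections; rewrite //= subrr.
move=> /Sfun /eqP; rewrite subr_eq0 => /eqP ->.
by rewrite -eE -mulrzA [c%:Z * l]mulrC -nl mulrNz addNr.
Qed.

Lemma extend_partial_morphism (S0 : set (M * D)) : S0 (0, 0) -> partial_morphism S0 ->
  exists g : M -> D, {morph g : x y / x + y} /\ forall m d, S0 (m, d) -> g m = d.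
Proof.
move=> S00 pS0.
(* Zorn's lemma is applied to all chains, the empty one included, so the empty set must satisfy [P];
   only nonempty sets are required to contain [S0]. *)
pose P (S : set (M * D)) := partial_morphism S /\ ((exists p, S p) -> (S0 `<=` S)%classic).
have [F FP Ftot|S [[pS S0S] Smax]] := @Zorn_bigcup (M * D)%type P.
  split; first split.
  - move=> p q [X FX Xp] [Y FY Yq].
    by have [XY|YX] := Ftot X Y FX FY; [exists Y => //|exists X => //];
      apply: (FP _ _).1.1 => //; [apply: XY|apply: YX].
  - by move=> d [X FX]; apply: (FP _ FX).1.2.
  by move=> [p [X FX Xp]] q /((FP _ FX).2 (ex_intro _ p Xp)) Xq; exists X.
have {}S0S : (S0 `<=` S)%classic.
  apply: contrapT => S0S'; apply: (Smax S0); last by split=> // _ p.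
  split=> // p Sp.
  by exfalso; apply: S0S'; apply: S0S; exists p.
have S0' : S (0, 0) by apply: S0S.
have Stot : forall m, exists d, S (m, d).
  apply: partial_morphism_total => // S' SS' [S'0 pS']; apply: (Smax S') => //.
  by split=> // _ p /S0S; apply: SS'.1.
have Suniq m d e : S (m, d) -> S (m, e) -> d = e.
  move=> Sd Se; apply/eqP; rewrite -subr_eq0; apply/eqP/pS.2.
  by have := pS.1 _ _ Sd Se; rewrite (_ : _ - _ = (0, d - e)) //;
    apply: injective_projections; rewrite //= subrr.
pose g m := sval (cid (Stot m)); have gP m : S (m, g m) := svalP (cid (Stot m)).
exists g; split=> [x y|m d /S0S Sd]; last exact: Suniq Sd.
apply: (Suniq (x + y)) => //.
have SN p : S p -> S (- p) by move=> Sp; rewrite -sub0r; apply: pS.1.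
have := pS.1 _ _ (gP x) (SN _ (gP y)); rewrite opprK.
by rewrite (_ : _ + _ = (x + y, g x + g y)).
Qed.

End Extension.

Definition rat_int : {pred rat} := fun x => x \is a Num.int.

Lemma rat_int_closed : zmod_closed rat_int.
Proof. by split=> [|x y xZ yZ]; rewrite unfold_in /rat_int; [apply: rpred0|apply: rpredB]. Qed.

HB.instance Definition _ := GRing.isZmodClosed.Build rat rat_int rat_int_closed.

Definition ratmodZ : zmodType :=
  Quotient.quot (GRing.ZmodClosed.clone rat rat_int _).

Definition ratmodZ_pi (x : rat) : ratmodZ :=
  \pi_(Quotient.quot (GRing.ZmodClosed.clone rat rat_int _))%qT x.

Lemma ratmodZ_piMn x n : ratmodZ_pi (x *+ n) = ratmodZ_pi x *+ n.
Proof. by rewrite /ratmodZ_pi raddfMn. Qed.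

Lemma ratmodZ_pi_onto x : exists y, ratmodZ_pi y = x.
Proof. by exists (repr x); rewrite /ratmodZ_pi reprK. Qed.

Lemma ratmodZ_pi0 x : ratmodZ_pi x = 0 <-> x \is a Num.int.
Proof.
rewrite -[0](raddf0 (\pi_(Quotient.quot (GRing.ZmodClosed.clone rat rat_int _)))%qT).
rewrite /ratmodZ_pi; split=> [/eqP|x_int].
  by rewrite piE /Quotient.equiv subr0.
by apply/eqP; rewrite piE /Quotient.equiv subr0.
Qed.

Lemma ratmodZ_divisible : divisible ratmodZ.
Proof.
move=> d x d_gt0; have [y <-] := ratmodZ_pi_onto x.
exists (ratmodZ_pi (y / d%:R)); rewrite -ratmodZ_piMn -(mulr_natr (y / d%:R)) mulfVK //.
by rewrite pnatr_eq0 -lt0n.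
Qed.

(** For [n > 1] the class of [1 / n] serves. For [n = 0] any nonzero class does, such as that of
    [1 / 2]. *)
Lemma ratmodZ_torsion (n : nat) : n != 1%N -> exists2 c : ratmodZ, c != 0 & c *+ n = 0.
Proof.
have key d : (1 < d)%N -> exists2 c : ratmodZ, c != 0 & c *+ d = 0.
  move=> d_gt1; have d_neq0 : d%:R != 0 :> rat.
    by rewrite pnatr_eq0 -lt0n ltnW.
  exists (ratmodZ_pi d%:R^-1).
    apply/eqP => /ratmodZ_pi0 /norm_intr_ge1; rewrite invr_eq0 => /(_ d_neq0).
    rewrite ger0_norm ?invr_ge0 ?ler0n // leNgt; case/negP.
    by rewrite invf_lt1 ?ltr0n ?ltr1n // ltnW.
  rewrite -ratmodZ_piMn -(mulr_natr d%:R^-1) mulVf //.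
  by apply/ratmodZ_pi0; apply: rpred1.
case: n => [|[//|n]] _; last exact: key.
by have [c c0 _] := key 2%N isT; exists c.
Qed.

(** [Q/Z] is a cogenerator: the annihilator of [v] is generated by some [c] other than 1, so [v] can
    be sent to a nonzero element killed by [c]. Divisibility extends this from the multiples of [v]
    to [M]. *)
Lemma ratmodZ_separates (M : zmodType) (v : M) : v != 0 ->
  exists2 g : M -> ratmodZ, {morph g : x y / x + y} & g v != 0.
Proof.
move=> v0; have [c cP] : exists c : nat, forall n : int, v *~ n = 0 <-> (c%:Z %| n)%Z.
  by apply: int_subgroup => // m n vm vn; rewrite mulrzBr vm vn subr0.
have c1 : c != 1%N.
  by apply: contra_neq v0 => c1; apply: (cP 1).2; rewrite c1.
have [e e0 ec] := ratmodZ_torsion c1.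
have [||g [gD gE]] := @extend_partial_morphism M _ ratmodZ_divisible
   (fun p => exists n : int, p = (v *~ n, e *~ n)); first by exists 0.
  split=> [_ _ [m ->] [n ->]|d [n [/esym /cP /dvdzP[q ->] ->]]].
    by exists (m - n); rewrite !mulrzBr.
  by rewrite mulrC mulrzA -pmulrn ec mul0rz.
by exists g => //; rewrite (gE v e) //; exists 1.
Qed.

End DivisibleGroups.

(** * Injective resolutions and lifting of invariants *)

Section Coinduced.
Variables (k : comNzRingType) (S : Type).

Definition additive_fun : {pred (k * S -> ratmodZ)} :=
  fun h => `[< forall a b s, h (a + b, s) = h (a, s) + h (b, s) >].

Lemma additive_fun_closed : zmod_closed additive_fun.
Proof.
split=> [|g h /asboolP gD /asboolP hD]; apply/asboolP => a b s.
  by rewrite addr0.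
by rewrite !fctE gD hD opprD addrACA.
Qed.

HB.instance Definition _ := GRing.isZmodClosed.Build _ additive_fun additive_fun_closed.

(* The coinduced k-module Hom_Z(k, (Q/Z)^S). *)
Record coinduced := Coinduced { coind_val : k * S -> ratmodZ;
                                coind_valP : coind_val \in additive_fun }.
HB.instance Definition _ := [isSub for coind_val].
HB.instance Definition _ := [Choice of coinduced by <:].
HB.instance Definition _ := [SubChoice_isSubZmodule of coinduced by <:].

Lemma coindD (h : coinduced) a b s :
  coind_val h (a + b, s) = coind_val h (a, s) + coind_val h (b, s).
Proof. by case: h => h /= /asboolP. Qed.

Lemma coind_ext (g h : coinduced) :
  (forall a s, coind_val g (a, s) = coind_val h (a, s)) -> g = h.
Proof. by move=> gh; apply/val_inj/funext => -[a s]; apply: gh. Qed.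

Lemma coind_addE (g h : coinduced) x : coind_val (g + h) x = coind_val g x + coind_val h x.
Proof. by []. Qed.

Lemma coind_scale_subproof c (h : coinduced) :
  (fun x : k * S => coind_val h (x.1 * c, x.2)) \in additive_fun.
Proof. by apply/asboolP => a b s; rewrite mulrDl coindD. Qed.

Definition coind_scale c h : coinduced := Coinduced (coind_scale_subproof c h).

Lemma coind_scaleA a b h : coind_scale a (coind_scale b h) = coind_scale (a * b) h.
Proof. by apply: coind_ext => c s /=; rewrite mulrA. Qed.

Lemma coind_scale1 : left_id 1 coind_scale.
Proof. by move=> h; apply: coind_ext => c s /=; rewrite mulr1. Qed.

Lemma coind_scaleDr : right_distributive coind_scale +%R.
Proof. by move=> a g h; apply: coind_ext. Qed.

Lemma coind_scaleDl h : {morph coind_scale^~ h : a b / a + b}.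
Proof. by move=> a b; apply: coind_ext => c s /=; rewrite mulrDr coindD. Qed.

HB.instance Definition _ := GRing.Zmodule_isLmodule.Build k coinduced
  coind_scaleA coind_scale1 coind_scaleDr coind_scaleDl.

Lemma coind_scaleE c (h : coinduced) a s : coind_val (c *: h) (a, s) = coind_val h (a * c, s).
Proof. by []. Qed.

(** By evaluation at 1, a linear map to the coinduced module is the same as a family of additive
    maps to [Q/Z] indexed by [S]. Each of these extends along [i] because [Q/Z] is divisible. *)
Lemma coinduced_injective (V W : lmodType k) (i : {linear V -> W})
    (f : {linear V -> coinduced}) : injective i ->
  exists g : {linear W -> coinduced}, forall v, g (i v) = f v.
Proof.
move=> i_inj.
have ext s : exists g : W -> ratmodZ, {morph g : x y / x + y} /\
    forall v, g (i v) = coind_val (f v) (1, s).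
  have [||g [gD gE]] := @extend_partial_morphism W _ ratmodZ_divisible
    (fun p => exists v, p = (i v, coind_val (f v) (1, s))).
  - by exists 0; rewrite !linear0.
  - split=> [_ _ [u ->] [v ->]|d [v [/esym iv ->]]].
      by exists (u - v); rewrite !linearB.
    by have -> : v = 0; [apply: i_inj; rewrite iv linear0|rewrite linear0].
  by exists g; split=> // v; apply: gE; exists v.
pose g s := sval (cid (ext s)).
have [gD gE] : (forall s x y, g s (x + y) = g s x + g s y) /\
    forall s v, g s (i v) = coind_val (f v) (1, s).
  by split=> s; rewrite /g; case: cid => ? [].
have hP w : (fun x : k * S => g x.2 (x.1 *: w)) \in additive_fun.
  by apply/asboolP => a b s /=; rewrite scalerDl gD.
pose h w := Coinduced (hP w).
have hl : linear h.
  move=> a x y; apply: coind_ext => b s.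
  by rewrite coind_addE coind_scaleE /= scalerDr gD scalerA.
exists (lin_of hl) => v; apply: coind_ext => a s /=.
by rewrite -linearZ gE linearZ coind_scaleE mul1r.
Qed.

End Coinduced.

(** * Enough injectives, resolutions and lifting *)

Section Resolutions.
Variables (k : comNzRingType).

(** The index set is [V] itself: the component at [s] is a character that does not vanish at [s], so
    a nonzero [v] is detected by its own component. *)
Lemma embed_coinduced (V : lmodType k) : exists j : {linear V -> coinduced k V}, injective j.
Proof.
have chi (s : V) : exists g : V -> ratmodZ, {morph g : x y / x + y} /\ (s != 0 -> g s != 0).
  have [->|/ratmodZ_separates[g gD gs]] := eqVneq s 0; last by exists g.
  by exists (fun=> 0); split=> [x y|/eqP//]; rewrite addr0.
pose g s := sval (cid (chi s)).
have [gD g0] : (forall s x y, g s (x + y) = g s x + g s y) /\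
    forall s, s != 0 -> g s s != 0.
  by split=> s; rewrite /g; case: cid => ? [].
have hP w : (fun x : k * V => g x.2 (x.1 *: w)) \in @additive_fun k V.
  by apply/asboolP => a b s /=; rewrite scalerDl gD.
pose h w := Coinduced (hP w).
have hl : linear h.
  move=> a x y; apply: coind_ext => b s.
  by rewrite coind_addE coind_scaleE /= scalerDr gD scalerA.
exists (lin_of hl); apply: raddf_inj => v hv; apply/eqP.
apply: contrapT => /negP /g0; rewrite -[X in g v X]scale1r.
by rewrite -[g v _]/(coind_val (h v) (1, v)) (hv : h v = 0) eqxx.
Qed.

Variable G : affine_group k.
Notation A := (coord_ring G).
Hypothesis A_flat : flat_module A.
Implicit Types (V W : gmodule G) (U : lmodType k).

(** The equivariant map that corresponds to [f] under the adjunction between forgetting the coaction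
    and [cofree]. *)
Definition coact_lin (V : gmodule G) (U : lmodType k) (f : {linear V -> U}) :
    {linear V -> cofree G U} := tens_map f idfun \o coact V.

Lemma coact_lin_equivariant V U (f : {linear V -> U}) :
  @gequivariant k G V (cofree G U) (coact_lin f).
Proof.
move=> v; rewrite /= /cofree_coact /= tens_map_swap -coactA.
rewrite [RHS](_ : _ = tens_map (tens_map f idfun) idfun
                        (tens_map (coact V) idfun (coact V v))).
  by rewrite -assoc_mapl assocK.
by rewrite tens_map_comp.
Qed.

Definition coact_hom V U (f : {linear V -> U}) : ghom V (cofree G U) :=
  GHom (coact_lin_equivariant f).

(** Consequently an equivariant map to a cofree module is determined by its composite with
    [counit_lift]. *)
Lemma cofree_counit U (t : cofree G U) :
  tens_map (@counit_lift _ G U) idfun (coact (cofree G U) t) = t.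
Proof.
apply: (@tens_ext _ _ _ _
  (tens_map (@counit_lift _ G U) idfun \o @cofree_coact _ G U) idfun) t => u a.
transitivity (tens_map (@counit_lift _ G U) (@idfun A) (cofree_coact (pure_map G u a))) => //.
rewrite cofree_coact_pure tens_map_comp -[RHS]/(pure_map G u a).
rewrite -[in RHS](@counitl _ G a) linear_lift; apply: eq_lift => x y /=.
rewrite /counit_lift (tens_lift_pure (@counit_bilin _ G _)).
by rewrite linearZr linearZl_LR.
Qed.

(** By adjunction, the extension problem becomes one for linear maps to the coinduced module, which
    is injective over [k]. *)
Lemma cofree_injective (S : Type) : injective_gmodule (cofree G (coinduced k S)).
Proof.
move=> V W i f i_inj.
have [g0 g0E] := coinduced_injective (@counit_lift _ G _ \o f) i_inj.
exists (coact_hom g0) => v; rewrite /= ghomP tens_map_comp.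
rewrite -[RHS]cofree_counit ghomP [RHS]tens_map_comp.
by apply: eq_tens_map.
Qed.

(** The embedding is the coaction, injective because the counit splits it, followed by [j ⊗ A],
    injective by flatness. *)
Lemma enough_injectives (V : gmodule G) :
  exists (I : gmodule G) (i : ghom V I), injective_gmodule I /\ injective i.
Proof.
have [j j_inj] := embed_coinduced V.
exists (cofree G (coinduced k V)), (coact_hom j); split; first exact: cofree_injective.
apply: (inj_comp (A_flat j_inj)) => x y xy.
by rewrite -[x]coactK xy coactK.
Qed.

Lemma tens_map0 (U V W Z : lmodType k) (f : {linear U -> V}) (g : {linear W -> Z}) t :
  (forall u, f u = 0) -> tens_map f g t = 0.
Proof. by move=> f0; apply: big1 => p _; rewrite f0 linear0l. Qed.

Lemma cokernel (V W : gmodule G) (i : ghom V W) :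
  exists (C : gmodule G) (p : ghom W C),
    (forall c, exists w, p w = c) /\ (forall w, p w = 0 <-> exists v, i v = w).
Proof.
have Isub : submodule (fun w => exists v, i v = w).
  split=> [|a _ _ [x <-] [y <-]]; first by exists 0; rewrite linear0.
  by exists (a *: x + y); rewrite linearP.
pose Q : lmodType k := quotmod Isub; pose q : {linear W -> Q} := quot_pi Isub.
have q_onto x : exists v, q v = x by apply: quot_pi_onto.
have q0 w : q w = 0 <-> exists v, i v = w by apply: quot_pi0.
pose rho x := tens_map q (@idfun A) (coact W (sval (cid (q_onto x)))).
have rhoE w : rho (q w) = tens_map q idfun (coact W w).
  rewrite /rho; case: cid => u /= /quot_pi_eq [v vE].
  apply/eqP; rewrite -subr_eq0 -!linearB -vE ghomP /= tens_map_comp; apply/eqP.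
  by apply: tens_map0 => x; apply/q0; exists x.
have rho_lin : linear rho.
  move=> a x y; have [u <-] := q_onto x; have [v <-] := q_onto y.
  by rewrite -linearP !rhoE !linearP.
have rhoE' w : lin_of rho_lin (q w) = tens_map q idfun (coact W w) by apply: rhoE.
by exists (gquot q_onto rhoE'), (@GHom _ _ W (gquot q_onto rhoE') q rhoE').
Qed.

Lemma ghom_comp_equivariant (U V W : gmodule G) (g : ghom V W) (f : ghom U V) :
  gequivariant (g \o f).
Proof. by move=> v; rewrite /= !ghomP tens_map_comp. Qed.

Definition ghom_comp (U V W : gmodule G) (g : ghom V W) (f : ghom U V) : ghom U W :=
  @GHom _ _ U W (g \o f) (ghom_comp_equivariant g f).

Record injective_step (V : gmodule G) := InjectiveStep {
  step_obj : gmodule G;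
  step_incl : ghom V step_obj;
  step_coker : gmodule G;
  step_proj : ghom step_obj step_coker;
  step_injective : injective_gmodule step_obj;
  step_incl_inj : injective step_incl;
  step_proj_onto : forall c, exists x, step_proj x = c;
  step_exact : forall x, step_proj x = 0 <-> exists v, step_incl v = x
}.

Lemma injective_step_exists (V : gmodule G) : exists s : injective_step V, True.
Proof.
have [I [i [I_inj i_inj]]] := enough_injectives V.
have [C [p [p_onto p0]]] := cokernel i.
by exists (InjectiveStep I_inj i_inj p_onto p0).
Qed.

Definition the_step (V : gmodule G) : injective_step V :=
  sval (cid (injective_step_exists V)).

Fixpoint syzygy (V : gmodule G) (n : nat) : gmodule G :=
  if n is m.+1 then step_coker (the_step (syzygy V m)) else V.

(** The short exact sequences of successive cokernels are spliced. Since [cohomology_vanishes]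
    quantifies over resolutions, it yields information only once one exists. *)
Lemma resolution_exists (V : gmodule G) : exists I : injective_resolution V, True.
Proof.
pose Z := syzygy V; pose s n := the_step (Z n).
pose d n : ghom (step_obj (s n)) (step_obj (s n.+1)) :=
  ghom_comp (step_incl (s n.+1)) (step_proj (s n)).
have d0 n x : d n x = 0 <-> step_proj (s n) x = 0.
  rewrite /d /= -(linear0 (step_incl (s n.+1))).
  by split=> [/step_incl_inj|->].
unshelve eexists; first last. exact: I.
unshelve eapply (@InjectiveResolution _ _ V (fun n => step_obj (s n)) d (step_incl (s 0%N))).
- by move=> n; apply: step_injective.
- exact: step_incl_inj.
- by move=> x; rewrite d0; apply: step_exact.
move=> n x; rewrite d0 step_exact; split=> [[z <-]|[y <-]].
  by have [y <-] := step_proj_onto z; exists y.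
by exists (step_proj (s n) y).
Qed.

Lemma ker_stable (V W : gmodule G) (p : ghom V W) z :
  exists t, tens_map (ker_incl p) (@idfun A) t = coact V (ker_incl p z).
Proof.
apply: (tens_ker A_flat); rewrite -ghomP.
by rewrite (sub_inclP z : p (ker_incl p z) = 0) linear0.
Qed.

Definition gker (V W : gmodule G) (p : ghom V W) : gmodule G :=
  gsub A_flat (@sub_incl_inj _ _ _ (ker_submodule p)) (@ker_stable V W p).

Definition gker_incl (V W : gmodule G) (p : ghom V W) : ghom (gker p) V :=
  gsub_incl A_flat (@sub_incl_inj _ _ _ (ker_submodule p)) (@ker_stable V W p).

(* Dimension shifting: [w] defines the 1-cocycle [d (phi w)] of the kernel [K]
   of [p], where [phi] extends the augmentation [K -> I_0] to [W]. *)
Lemma lift_invariant (V W : gmodule G) (p : ghom W V) (w : W) :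
  (forall V : gmodule G, cohomology_vanishes 1 V) -> ginvariant (p w) ->
  exists w', ginvariant w' /\ p w' = p w.
Proof.
move=> H1 pw_inv.
pose K := gker p; pose i : ghom K W := gker_incl p.
have i_inj : injective i by apply: sub_incl_inj.
have [I _] := resolution_exists K.
have [phi phiE] := @res_injective _ _ _ I 0%N K W i (res_aug I) i_inj.
(* The failure of [x] to be invariant is measured in [K ⊗ A], which is the kernel of [p ⊗ A] by
   flatness. *)
have defect x : ginvariant (p x) -> exists t, tens_map i (@idfun A) t = coact W x - x *t 1.
  move=> px; apply: (tens_ker A_flat).
  by rewrite linearB /= -ghomP px tens_map_pure subrr.
have dphi_inv : ginvariant (res_diff I 0 (phi w)).
  have [t tE] := defect w pw_inv.
  apply/eqP; rewrite -subr_eq0; apply/eqP.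
  transitivity (tens_map (res_diff I 0 \o phi) idfun (tens_map i idfun t)).
    by rewrite tE linearB /= tens_map_pure /= !ghomP tens_map_comp.
  rewrite [LHS]tens_map_comp; apply: tens_map0 => z /=.
  by rewrite phiE; apply/res_exact0; exists z.
have dd0 : res_diff I 1 (res_diff I 0 (phi w)) = 0 by apply/res_exact; exists (phi w).
have [y y_inv dy] := H1 K I _ (conj dphi_inv dd0).
(* [phi w] differs from the invariant [y] by the image of some [v] in [K]; subtracting [v] from [w]
   leaves [p w] unchanged and moves [phi w] to [y]. *)
have /res_exact0[v vE] : res_diff I 0 (phi w - y) = 0 by rewrite linearB dy subrr.
exists (w - i v); have pE : p (w - i v) = p w.
  by rewrite linearB (sub_inclP v : p (i v) = 0) subr0.
split=> //; have [|t tE] := defect (w - i v); first by rewrite /ginvariant pE.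
have phiwv : phi (w - i v) = y by rewrite linearB phiE vE opprB addrC subrK.
suff t0 : t = 0 by apply/eqP; rewrite /ginvariant -subr_eq0 -tE t0 linear0.
(* On [K] the map [phi] is the augmentation, which stays injective after tensoring with [A]. It
   sends the defect of [w - i v] to that of [y], which is zero. *)
apply: (A_flat (@res_aug_inj _ _ _ I)); rewrite linear0.
transitivity (tens_map phi idfun (tens_map i idfun t)).
  by rewrite [RHS]tens_map_comp; apply: eq_tens_map => // z; rewrite -phiE.
by rewrite tE linearB /= -ghomP tens_map_pure /= phiwv y_inv subrr.
Qed.

End Resolutions.

(** * The antipode *)

Section Hopf.
Variables (k : comNzRingType) (G : affine_group k).
Notation A := (coord_ring G).
Notation S := (antipode G).

Section Convolution.
Variables (B : lmodType k) (m : B -> B -> B) (e : B).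
Hypotheses (m_bilin : bilin m) (mA : associative m).
Hypotheses (m1 : left_id e m) (m2 : right_id e m).
Implicit Types f g h : {linear A -> B}.

Definition conv (f g : A -> B) (a : A) : B :=
  tens_lift (fun x y => m (f x) (g y)) (comul G a).

Lemma conv_bilin f g : bilin (fun x y => m (f x) (g y)).
Proof.
split=> [y|x]; first exact: linear_comp (m_bilin.1 (g y)) (linearP f).
exact: linear_comp (m_bilin.2 (f x)) (linearP g).
Qed.

Lemma conv_linear f g : linear (conv f g).
Proof. exact: linear_comp (tens_lift_linear (conv_bilin f g)) (linearP (comul G)). Qed.

Lemma convA f g h a : conv f (conv g h) a = conv (conv f g) h a.
Proof.
rewrite /conv; pose T x y z := m (f x) (m (g y) (h z)).
transitivity (tens_lift (fun x y => tens_lift (T x) (comul G y)) (comul G a)).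
  by apply: eq_lift => x y; rewrite -(linear_lift (lin_of (m_bilin.2 (f x)))).
rewrite -(@coassoc_lift _ _ (regular G)); first last.
- by move=> x y; apply: linear_comp (m_bilin.2 _) (linear_comp (m_bilin.2 _) (linearP h)).
- move=> x z; apply: linear_comp (m_bilin.2 _) _.
  exact: linear_comp (m_bilin.1 _) (linearP g).
- by move=> y z; apply: linear_comp (m_bilin.1 _) (linearP f).
apply: eq_lift => x y; rewrite -[RHS]/(lin_of (m_bilin.1 (h y)) (conv f g x)).
rewrite linear_lift.
by apply: eq_lift => x' y'; rewrite /T mA.
Qed.

Definition conv_unit (f : A -> B) := forall a, f a = counit G a *: e.

Lemma conv_unitl (f : A -> B) h a : conv_unit f -> conv f h a = h a.
Proof.
move=> f1; rewrite -[in RHS](counitl a) linear_lift; apply: eq_lift => x y.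
by rewrite f1 -[LHS]/(lin_of (m_bilin.1 (h y)) _) linearZ /= m1 linearZ.
Qed.

Lemma conv_unitr (h : A -> B) f a : conv_unit h -> conv f h a = f a.
Proof.
move=> h1; rewrite -[in RHS](counitr a) linear_lift; apply: eq_lift => x y.
by rewrite h1 -[LHS]/(lin_of (m_bilin.2 (f x)) _) linearZ /= m2 linearZ.
Qed.

(** In convolution notation, [f = f * (g * h) = (f * g) * h = h]. *)
Lemma conv_inverse_unique f g h :
  conv_unit (conv f g) -> conv_unit (conv g h) -> f =1 h.
Proof.
move=> fg gh a; rewrite -(conv_unitl h a fg).
by rewrite -[conv f g]/(lin_of (conv_linear f g) : _ -> _) -convA conv_unitr.
Qed.

End Convolution.

(** The counit is applied to [S(a_1) a_2 = ε(a)]; by multiplicativity and the counit axiom the left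
    side becomes [ε(S a)]. *)
Lemma counit_antipode a : counit G (S a) = counit G a.
Proof.
have -> : counit G (S a) = counit G (tens_lift (fun x y => S x * y) (comul G a)).
  rewrite -[in LHS](counitr a) /tens_lift !raddf_sum; apply: eq_bigr => -[x y] _ /=.
  by rewrite rmorphM linearZ /= linearZ /= mulrC.
by rewrite antipodel linearZ /= rmorph1 mulr1.
Qed.

Lemma tens_mul_bilin : bilin (@tens_mul k A A).
Proof.
split=> [y|x]; first exact: tens_lift_linear (tens_mul_bilinear y).
by apply: lift_param => a b; apply: tens_lift_linear (tens_mul_bilinear1 a b).
Qed.

Lemma tens_mulA : associative (@tens_mul k A A).
Proof.
have [bl br] := tens_mul_bilin.
move=> x y z; move: x; apply: tens_eq => [||a a'].
- exact: bl.
- exact: linear_comp (bl z) (bl y).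
move: y; apply: tens_eq => [||b b'].
- exact: linear_comp (br _) (bl z).
- exact: linear_comp (bl z) (br _).
move: z; apply: tens_eq => [||c c'].
- exact: linear_comp (br _) (br _).
- exact: br.
by rewrite !tens_mul_pure !mulrA.
Qed.

Lemma tens_mul1 : left_id (1 *t 1) (@tens_mul k A A).
Proof.
apply: tens_eq => [|//|a b]; first exact: (tens_mul_bilin.2 _).
by rewrite tens_mul_pure !mul1r.
Qed.

Lemma tens_mulr1 : right_id (1 *t 1) (@tens_mul k A A).
Proof.
apply: tens_eq => [|//|a b]; first exact: (tens_mul_bilin.1 _).
by rewrite tens_mul_pure !mulr1.
Qed.

(* Both sides are convolution inverses of [comul = i1 * i2], where [i1] and [i2]
   are the two inclusions of [A] in [A ⊗ A]. *)
Lemma comul_antipode a :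
  comul G (S a) = tens_lift (fun x y => S y *t S x) (comul G a).
Proof.
pose i1 : {linear A -> tensor A A} := lin_of (pure_linl (1 : A)).
pose i2 : {linear A -> tensor A A} := lin_of (pure_linr (1 : A)).
pose i1S : {linear A -> tensor A A} := i1 \o S.
pose i2S : {linear A -> tensor A A} := i2 \o S.
have cl := @conv_linear _ _ tens_mul_bilin.
have cA := @convA _ _ tens_mul_bilin tens_mulA.
pose h : {linear A -> tensor A A} := lin_of (cl i2S i1S).
have hE b : h b = tens_lift (fun x y => S y *t S x) (comul G b).
  by apply: eq_lift => x y; rewrite tens_mul_pure mul1r mulr1.
have i1V : conv_unit (1 *t 1) (conv (@tens_mul k A A) i1 i1S).
  move=> b; transitivity (i1 (counit G b)%:A); last by rewrite linearZ.
  rewrite -antipoder linear_lift.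
  by apply: eq_lift => x y; rewrite tens_mul_pure mulr1.
have i2V : conv_unit (1 *t 1) (conv (@tens_mul k A A) i2 i2S).
  move=> b; transitivity (i2 (counit G b)%:A); last by rewrite linearZ.
  rewrite -antipoder linear_lift.
  by apply: eq_lift => x y; rewrite tens_mul_pure mulr1.
have comulE : comul G =1 conv (@tens_mul k A A) i1 i2.
  move=> b; rewrite -[LHS]lift_pure; apply: eq_lift => x y.
  by rewrite tens_mul_pure mulr1 mul1r.
rewrite -hE; apply: (conv_inverse_unique tens_mul_bilin tens_mulA tens_mul1
  tens_mulr1 (f := comul G \o S) (g := comul G)) => b.
  rewrite -[RHS](_ : comul G (counit G b)%:A = _); last by rewrite linearZ /= comul1.
  rewrite -antipodel linear_lift; apply: eq_lift => x y.
  by rewrite comulM.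
(* In [(i1 * i2) * (i2S * i1S)] the inner pair cancels by [i2V], after which the outer pair cancels
   by [i1V]. *)
rewrite [LHS](_ : _ = conv (@tens_mul k A A) (lin_of (cl i1 i2)) h b); last first.
  by apply: eq_lift => x y; rewrite comulE.
rewrite -[RHS]i1V -[lin_of _ : _ -> _]/(conv (@tens_mul k A A) i1 i2) -cA.
apply: eq_lift => x y; congr tens_mul.
rewrite [LHS]cA; exact: (conv_unitl tens_mul_bilin tens_mul1 i1S y i2V).
Qed.

End Hopf.

(** * Modules over noetherian rings *)

Section Noetherian.
Variable k : comNzRingType.
Hypothesis k_noeth : noetherian_ring k.

(** [noetherian_ring] concerns proper ideals, so an ideal containing 1 is treated apart, with
    generator 1. Writing the generators as a column turns combinations into matrix products. *)
Lemma noetherian_ideal (J : k -> Prop) : J 0 ->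
  (forall a u v, J u -> J v -> J (a * u + v)) ->
  exists (m : nat) (r : 'cV[k]_m), forall x, J x <-> exists c : 'rV[k]_m, x = (c *m r) 0 0.
Proof.
move=> J0 JD; have [J1|nJ1] := pselect (J 1).
  exists 1%N, 1%:M => x; split=> _; first by exists x%:M; rewrite mulmx1 mxE eqxx mulr1n.
  by have := JD x 1 0 J1 J0; rewrite mulr1 addr0.
have [|m [r rP]] := k_noeth (J := fun x => `[< J x >]).
  split; first exact/asboolP.
    by apply/negP => /asboolP.
  by move=> a u v /asboolP Ju /asboolP Jv; apply/asboolP/JD.
exists m, (\col_j r j) => x; split=> [/asboolP /rP [c ->]|[c ->]].
  by exists (\row_j c j); rewrite !mxE; apply: eq_bigr => j _; rewrite !mxE.
apply/asboolP/rP; exists (fun j => c 0 j).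
by rewrite !mxE; apply: eq_bigr => j _; rewrite !mxE.
Qed.

(** Induction on the rank: the first entries of rows in [P] form an ideal, whose generators lift to
    rows [X1] of [P]. Subtracting a combination of these leaves a row with first entry 0, to which
    the induction hypothesis applies. *)
Lemma noetherian_row_module n (P : 'rV[k]_n -> Prop) : submodule P ->
  exists (m : nat) (r : 'M[k]_(m, n)), forall x, P x <-> exists c : 'rV_m, x = c *m r.
Proof.
elim: n P => [|n IHn] P [P0 PD].
  exists 0%N, 0 => x; split=> _; last by rewrite (thinmx0 x) -(thinmx0 0).
  by exists 0; rewrite !thinmx0.
have {P P0 PD} [P1 [P10 P1D ->]] : exists P1 : 'rV[k]_(1 + n) -> Prop,
  [/\ P1 0, forall a u v, P1 u -> P1 v -> P1 (a *: u + v) & P = P1] by exists P.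
suff : exists (m : nat) (r : 'M[k]_(m, 1 + n)), forall x : 'rV_(1 + n),
  P1 x <-> exists c : 'rV_m, x = c *m r by [].
have [||m1 [r1 r1P]] := @noetherian_ideal (fun a => exists2 x, P1 x & x 0 0 = a).
- by exists 0; rewrite ?mxE.
- move=> a _ _ [x Px <-] [y Py <-]; exists (a *: x + y); first exact: P1D.
  by rewrite !mxE.
have [|m2 [r2 r2P]] := IHn (fun y => P1 (row_mx 0 y)).
  split=> [|a y z Py Pz]; first by rewrite row_mx0.
  by have := P1D a _ _ Py Pz; rewrite scale_row_mx add_row_mx scaler0 addr0.
have X j : exists x, P1 x /\ x 0 0 = r1 j 0.
  have [|x Px x0] := (r1P (r1 j 0)).2; last by exists x.
  by exists (delta_mx 0 j); rewrite -rowE mxE.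
pose X1 : 'M[k]_(m1, 1 + n) := \matrix_(j < m1) sval (cid (X j)).
have PM m (c : 'rV[k]_m) (M : 'M_(m, 1 + n)) : (forall j, P1 (row j M)) -> P1 (c *m M).
  move=> PM; rewrite mulmx_sum_row.
  apply: (big_ind P1) => // [x y Px Py|j _].
    by have := P1D 1 x y Px Py; rewrite scale1r.
  by have := P1D (c 0 j) _ 0 (PM j) P10; rewrite addr0.
have PX1 j : P1 (row j X1) by rewrite rowK; case: cid => ? [].
have X10 : lsubmx X1 = r1.
  apply/colP => j; rewrite !mxE.
  by case: cid => y /= [_ <-]; congr (y _ _); apply: val_inj.
exists (m1 + m2)%N, (col_mx X1 (row_mx 0 r2)) => x; split=> [Px|[c ->]].
  have [|c1 c1E] := (r1P (x 0 0)).1; first by exists x.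
  pose y := x - c1 *m X1.
  have Py : P1 y by have := P1D (-1) _ _ (PM _ c1 X1 PX1) Px; rewrite scaleN1r addrC.
  have yE : y = row_mx 0 (rsubmx y).
    rewrite -[LHS]hsubmxK; congr row_mx; apply/rowP => i; rewrite ord1.
    have xE : x 0 0 = lsubmx x 0 0 by rewrite mxE; congr (x _ _); apply: val_inj.
    by rewrite linearB /= -mulmx_lsub X10 [LHS]mxE [X in _ + X]mxE -c1E xE subrr mxE.
  have [|c2 c2E] := (r2P (rsubmx y)).1; first by rewrite -yE.
  exists (row_mx c1 c2); rewrite mul_row_col mul_mx_row mulmx0 -c2E -yE.
  by rewrite /y addrC subrK.
apply: PM => j; case: (split_ordP j) => i ->.
  by rewrite rowKu; apply: PX1.
rewrite rowKd row_row_mx row0; apply/r2P.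
by exists (delta_mx 0 i); rewrite -rowE.
Qed.

Definition finitely_generated (F : lmodType k) :=
  exists (n : nat) (p : {linear 'rV[k]_n -> F}), forall x, exists c, p c = x.

(** The coordinate vectors whose image in [F] comes from [N] form a submodule of [k^n]; its
    generators give those of [N]. *)
Lemma finitely_generated_sub (N F : lmodType k) (i : {linear N -> F}) :
  injective i -> finitely_generated F -> finitely_generated N.
Proof.
move=> i_inj [n [p p_onto]].
have [|m [r rP]] := @noetherian_row_module n (fun c => exists x, i x = p c).
  split=> [|a u v [x xE] [y yE]]; first by exists 0; rewrite !linear0.
  by exists (a *: x + y); rewrite !linearP xE yE.
have ex (c : 'rV_m) : exists x, i x = p (c *m r) by apply/rP; exists c.
pose q c := sval (cid (ex c)).
have qE c : i (q c) = p (c *m r) := svalP (cid (ex c)).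
have ql : linear q.
  by move=> a x y; apply: i_inj; rewrite linearP !qE mulmxDl -scalemxAl linearP.
exists m, (lin_of ql) => x; have [c cE] := p_onto (i x).
have [d dE] : exists d : 'rV_m, c = d *m r by apply/rP; exists x.
by exists d; apply: i_inj; rewrite /= qE -dE.
Qed.

End Noetherian.

(** * Coordinates on the tensor product of a module with [k^n] *)

Section RowTensor.
Variables (k : comNzRingType) (M : lmodType k) (n : nat).

Definition tens_coord (i : 'I_n) : tensor 'rV[k]_n M -> M :=
  tens_lift (fun (v : 'rV[k]_n) (m : M) => v 0 i *: m).

Lemma tens_coord_bilin (i : 'I_n) : bilin (fun (v : 'rV[k]_n) (m : M) => v 0 i *: m).
Proof.
split=> [m|v] a x y /=; first by rewrite !mxE scalerDl scalerA.
by rewrite scalerDr !scalerA mulrC.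
Qed.

HB.instance Definition _ i := GRing.isLinear.Build k (tensor 'rV[k]_n M) M *:%R
  (tens_coord i) (tens_lift_linear (tens_coord_bilin i)).

Lemma tens_coord_pure i v m : tens_coord i (v *t m) = v 0 i *: m.
Proof. exact: tens_lift_pure (tens_coord_bilin i) _ _. Qed.

Lemma tens_row_sum (t : tensor 'rV[k]_n M) :
  t = \sum_i delta_mx 0 i *t tens_coord i t.
Proof.
move: t; apply: tens_eq => [//|a x y|v m].
  rewrite scaler_sumr -big_split /=; apply: eq_bigr => i _.
  by rewrite linearP /= linearPr.
rewrite [v in LHS]row_sum_delta -[LHS]/(lin_of (pure_linl m) _) linear_sum /=.
apply: eq_bigr => i _; by rewrite tens_coord_pure linearZr linearZl_LR.
Qed.

Lemma tens_row_eq0 (t : tensor 'rV[k]_n M) : (forall i, tens_coord i t = 0) -> t = 0.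
Proof. by move=> t0; rewrite [t]tens_row_sum big1 // => i _; rewrite t0 linear0r. Qed.

End RowTensor.

(** * Dual G-modules *)

Section Dual.
Variables (k : comNzRingType) (F : lmodType k).

Lemma linear_fun_submodule : submodule (fun f : F -> k^o => linear f).
Proof.
split=> [a x y|b f g fl gl a x y].
  by have E z : (0 : F -> k^o) z = 0 by []; rewrite !E scaler0 addr0.
have E z : (b *: f + g) z = b *: f z + g z by [].
by rewrite !E fl gl !scalerDr !scalerA [b * a]mulrC addrACA.
Qed.

Definition dual : lmodType k := submod linear_fun_submodule.

Definition dual_fun (f : dual) : {linear F -> k^o} := lin_of (sub_inclP f).

Lemma dual_fun_linear x : linear (fun f => dual_fun f x).
Proof. by move=> a f g. Qed.

Lemma dual_funP a (f g : dual) x :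
  dual_fun (a *: f + g) x = a * dual_fun f x + dual_fun g x :> k.
Proof. by []. Qed.

Lemma dual_onto (f : F -> k^o) : linear f -> exists f' : dual, dual_fun f' =1 f.
Proof. by move=> /(sub_incl_onto linear_fun_submodule)[f' <-]; exists f'. Qed.

Lemma dual_ext (f g : dual) : dual_fun f =1 dual_fun g -> f = g.
Proof. by move=> fg; apply/(@sub_incl_inj _ _ _ linear_fun_submodule)/funext. Qed.

Section Eval.
Variable M : lmodType k.

(** The canonical map [F^* ⊗ M -> Hom(F, M)], with the resulting linear map evaluated at [x]. *)
Definition dual_eval (x : F) : tensor dual M -> M :=
  tens_lift (fun f m => (dual_fun f x : k) *: m).

Lemma dual_eval_bilin x : bilin (fun (f : dual) (m : M) => (dual_fun f x : k) *: m).
Proof.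
split=> [m|f] a u v /=; last by rewrite scalerDr !scalerA mulrC.
by rewrite -[LHS]/((dual_fun (a *: u + v) x : k) *: m) dual_funP scalerDl -scalerA.
Qed.

HB.instance Definition _ x := GRing.isLinear.Build k (tensor dual M) M *:%R
  (dual_eval x) (tens_lift_linear (dual_eval_bilin x)).

Lemma dual_eval_pure x f m : dual_eval x (f *t m) = (dual_fun f x : k) *: m.
Proof. exact: tens_lift_pure (dual_eval_bilin x) _ _. Qed.

Lemma dual_eval_linear t : linear (fun x => dual_eval x t).
Proof.
apply: lift_param => f m a x y.
by rewrite linearP scalerDl -[(_ *: _ : k^o)]/(a * _) -scalerA.
Qed.

Hypothesis k_noeth : noetherian_ring k.
Hypothesis F_fg : finitely_generated F.
Hypothesis M_flat : flat_module M.

(* A presentation of [F] by [r] relations embeds the dual in k^n as the kernel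
   of the transpose of [r]; tensoring with the flat module [M] preserves this. *)
Lemma dual_tensor :
  (forall t : tensor dual M, (forall x, dual_eval x t = 0) -> t = 0) /\
  (forall h : {linear F -> M}, exists t, forall x, dual_eval x t = h x).
Proof.
have [n [p p_onto]] := F_fg.
have [m [r rP]] := noetherian_row_module k_noeth (ker_submodule p).
pose iota (f : dual) : 'rV[k]_n := \row_i dual_fun f (p (delta_mx 0 i)).
have iota_lin : linear iota by move=> a f g; apply/rowP => i; rewrite !mxE dual_funP.
have ext (U : lmodType k) (f g : {linear F -> U}) :
    (forall i, f (p (delta_mx 0 i)) = g (p (delta_mx 0 i))) -> f =1 g.
  move=> fg x; have [c <-] := p_onto x; rewrite [c]row_sum_delta !linear_sum /=.
  by apply: eq_bigr => i _; rewrite !linearZ /= fg.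
have iota_inj : injective (lin_of iota_lin).
  move=> f g /rowP fg; apply: dual_ext; apply: ext => i.
  by have := fg i; rewrite !mxE.
have coordE t i : tens_coord i (tens_map (lin_of iota_lin) (@idfun M) t) =
    dual_eval (p (delta_mx 0 i)) t.
  rewrite /tens_coord lift_map; last exact: tens_coord_bilin.
  by apply: eq_lift => f u /=; rewrite mxE.
split=> [t t0|h].
  apply: (M_flat iota_inj); rewrite linear0.
  by apply: tens_row_eq0 => i; rewrite coordE t0.
pose rho : {linear 'rV[k]_n -> 'rV[k]_m} := mulmxr r^T.
(* [t0] records the values of [h] on the generators. It lies in the kernel of [rho ⊗ M] because [h]
   respects the relations [r]. *)
pose t0 : tensor 'rV[k]_n M := \sum_i delta_mx 0 i *t h (p (delta_mx 0 i)).
have t0E i : tens_coord i t0 = h (p (delta_mx 0 i)).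
  rewrite linear_sum (bigD1 i) //= big1 ?addr0 => [|j ji]; rewrite tens_coord_pure mxE.
    by rewrite !eqxx scale1r.
  by rewrite eq_sym (negPf ji) andbF scale0r.
have rho_t0 : tens_map rho (@idfun M) t0 = 0.
  apply: tens_row_eq0 => j.
  rewrite /t0 (linear_sum (tens_map rho idfun)) (linear_sum (@tens_coord k M m j)) /=.
  transitivity (h (p (row j r))).
    rewrite [row j r]row_sum_delta !linear_sum /=; apply: eq_bigr => i _.
    by rewrite tens_map_pure tens_coord_pure /= -rowE !mxE !linearZ.
  have -> : p (row j r) = 0 by apply/rP; exists (delta_mx 0 j); rewrite -rowE.
  by rewrite linear0.
have [t1 t1E] := tens_ker M_flat rho_t0.
(* A vector killed by the transposed relations defines a functional on [k^n] that vanishes on the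
   kernel of [p], hence a functional on [F]. *)
have kap (z : ker rho) : exists f, iota f = ker_incl rho z.
  set v := ker_incl rho z; have vr : v *m r^T = 0 by apply: sub_inclP z.
  pose f x := (sval (cid (p_onto x)) *m v^T) 0 0 : k^o.
  have fE c : f (p c) = (c *m v^T) 0 0.
    rewrite /f; case: cid => d /= dc.
    have /rP[e eE] : p (d - c) = 0 by rewrite linearB dc subrr.
    have -> : d = e *m r + c by rewrite -eE subrK.
    rewrite mulmxDl mxE -mulmxA -[r]trmxK -trmx_mul vr trmx0 mulmx0.
    by rewrite mxE add0r.
  have [a x y|f' f'E] := @dual_onto f.
    have [c <-] := p_onto x; have [d <-] := p_onto y.
    by rewrite -linearP !fE mulmxDl -scalemxAl !mxE.
  by exists f'; apply/rowP => i; rewrite mxE f'E fE -rowE !mxE.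
pose kappa z := sval (cid (kap z)).
have kappaE z : iota (kappa z) = ker_incl rho z := svalP (cid (kap z)).
have kappa_lin : linear kappa.
  move=> a x y; apply: iota_inj.
  by rewrite /= kappaE [RHS]iota_lin !kappaE linearP.
exists (tens_map (lin_of kappa_lin) idfun t1).
apply: (ext _ (lin_of (dual_eval_linear _)) h) => i; rewrite /= -coordE -t0E -t1E.
congr (tens_coord i _).
rewrite -[tens_map kappa _]/(tens_map (lin_of kappa_lin) _) tens_map_comp.
by apply: eq_tens_map => // z; apply: kappaE.
Qed.

Lemma dual_tensor_inj (s t : tensor dual M) :
  (forall x, dual_eval x s = dual_eval x t) -> s = t.
Proof.
move=> st; apply/eqP; rewrite -subr_eq0; apply/eqP/dual_tensor.1 => x.
by rewrite linearB /= st subrr.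
Qed.

End Eval.
End Dual.

(** * The contragredient module and equivariant functionals *)

Section DualModule.
Variables (k : comNzRingType) (G : affine_group k).
Notation A := (coord_ring G).
Notation S := (antipode G).
Hypothesis A_flat : flat_module A.
Hypothesis k_noeth : noetherian_ring k.
Variable F : gmodule G.
Hypothesis F_fg : finitely_generated F.

(** The function [g |-> f(g^-1 x)] on the group; the antipode accounts for the inverse. *)
Definition contragredient (f : dual F) (x : F) : A :=
  tens_lift (fun y a => (dual_fun f y : k) *: S a) (coact F x).

Lemma contragredient_linear f : linear (contragredient f).
Proof.
exact: linear_comp (tens_lift_linear (functional_bilinl (dual_fun f) S)) (linearP (coact F)).
Qed.

Lemma dual_coact_exists f :
  exists t, forall x, dual_eval x t = lin_of (contragredient_linear f) x.
Proof. exact: (dual_tensor k_noeth F_fg A_flat).2. Qed.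

Definition dual_coact f := sval (cid (dual_coact_exists f)).

Lemma dual_coactE f x : dual_eval x (dual_coact f) = contragredient f x.
Proof. exact: svalP (cid (dual_coact_exists f)) x. Qed.

Lemma dual_coact_linear : linear dual_coact.
Proof.
move=> a f g; apply: (dual_tensor_inj k_noeth F_fg A_flat) => x.
rewrite linearP /= !dual_coactE /contragredient.
rewrite (lift_param (b := fun f y b => (dual_fun f y : k) *: S b)) // => y b c u v.
by rewrite dual_funP scalerDl -scalerA.
Qed.
HB.instance Definition _ := GRing.isLinear.Build k (dual F) (tensor (dual F) A) *:%R
  dual_coact dual_coact_linear.

Lemma dual_eval_assoc (t : tensor (tensor (dual F) A) A) x :
  dual_eval x (tens_assoc t) = tens_map (@dual_eval _ F A x) idfun t.
Proof.
apply: (@linear_eq3l _ _ _ _ _ (@dual_eval _ F _ x \o @tens_assoc k _ _ _)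
  (tens_map (@dual_eval _ F A x) idfun)) t => f a b /=.
rewrite tens_assoc_pure tens_map_pure !dual_eval_pure /=.
by rewrite dual_eval_pure linearZl_LR.
Qed.

(** Elements of [F^* ⊗ (A ⊗ A)] may be compared by evaluation at [x]. Both sides become the sum of
    [f(x_0) S(x_2) ⊗ S(x_1)], the right one because [S] reverses the comultiplication. *)
Lemma dual_coactA f :
  tens_assoc (tens_map dual_coact idfun (dual_coact f)) =
  tens_map idfun (comul G) (dual_coact f).
Proof.
apply: (dual_tensor_inj k_noeth F_fg (flat_tensor A_flat A_flat)) => x.
rewrite dual_eval_assoc tens_map_comp.
transitivity (comul G (contragredient f x)); last first.
  rewrite -dual_coactE linear_lift /dual_eval lift_map; last exact: dual_eval_bilin.
  by apply: eq_lift => g a /=; rewrite linearZ.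
pose T y a b : tensor A A := (dual_fun f y : k) *: (S b *t S a).
transitivity (tens_lift (fun y b => tens_lift (fun y' a => T y' a b) (coact F y))
                (coact F x)); last first.
  rewrite coassoc_lift /contragredient.
  - rewrite linear_lift; apply: eq_lift => y a.
    by rewrite linearZ /= comul_antipode -[RHS]/(( *:%R _) _) linear_lift.
  - move=> a b c u v.
    by rewrite /T (linearP (dual_fun f)) scalerDl -[(_ *: _ : k^o)]/(c * _) scalerA.
  - by move=> y b c u v; rewrite /T (linearP S) linearPr scalerDr !scalerA mulrC.
  - by move=> y a c u v; rewrite /T (linearP S) linearPl scalerDr !scalerA mulrC.
transitivity (tens_lift (fun y b => S b *t dual_eval y (dual_coact f)) (coact F x)).
  rewrite /tens_map.
  transitivity (tens_lift (fun g a => tens_lift (fun y b => S b *t ((dual_fun g y : k) *: a))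
                  (coact F x)) (dual_coact f)).
    apply: eq_lift => g a /=; rewrite dual_coactE /contragredient.
    rewrite -[LHS]/(lin_of (pure_linl a) _) linear_lift; apply: eq_lift => y b /=.
    by rewrite linearZl_LR linearZr.
  rewrite /tens_lift exchange_big /=; apply: eq_bigr => p _.
  by rewrite /dual_eval /tens_lift linear_sumr.
apply: eq_lift => y b; rewrite dual_coactE /contragredient.
rewrite -[LHS]/(lin_of (pure_linr (S b)) _) linear_lift; apply: eq_lift => y' a.
by rewrite /T /= linearZr.
Qed.

Lemma dual_coact1 f : counit_lift (dual_coact f) = f.
Proof.
apply: dual_ext => x; rewrite -[LHS]/(lin_of (dual_fun_linear x) _) linear_lift.
transitivity (counit G (dual_eval x (dual_coact f)) : k^o).
  rewrite /dual_eval /tens_lift raddf_sum; apply: eq_bigr => -[g a] _ /=.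
  by rewrite linearZ; exact: mulrC.
rewrite dual_coactE -[in RHS](coactK x) /counit_lift linear_lift.
rewrite /contragredient /tens_lift raddf_sum; apply: eq_bigr => -[y a] _ /=.
rewrite -[RHS]/(dual_fun f (counit G a *: y)) (linearZ_LR (dual_fun f)) linearZ /=.
by rewrite counit_antipode; exact: mulrC.
Qed.

Definition gdual : gmodule G := GModule dual_coactA dual_coact1.

Lemma map_functional (U : lmodType k) (f : {linear U -> k^o}) (t : tensor U A) :
  tens_map f (@idfun A) t = (1 : k^o) *t tens_lift (fun y a => (f y : k) *: a) t.
Proof.
rewrite -[RHS]/(lin_of (pure_linr (1 : k^o)) _) linear_lift.
apply: eq_lift => y a /=; rewrite linearZr -linearZl_LR.
by congr (_ *t _); rewrite /= -[RHS]/(_ * 1) mulr1.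
Qed.

Lemma eval_equivariant (u : F) : ginvariant u ->
  @gequivariant k G gdual (trivial G k^o) (lin_of (dual_fun_linear u)).
Proof.
move=> u_inv f.
rewrite map_functional -[tens_lift _ _]/(dual_eval u (dual_coact f)) dual_coactE.
rewrite /contragredient u_inv (tens_lift_pure (functional_bilinl _ _)).
by rewrite rmorph1 linearZr -linearZl_LR -[_ *: 1]/(_ * 1) mulr1.
Qed.

Lemma equivariant_functional (u : F) (th : {linear F -> k^o}) :
  (forall V : gmodule G, cohomology_vanishes 1 V) -> ginvariant u -> th u = 1 ->
  exists f : ghom F (trivial G k^o), f u = 1.
Proof.
move=> H1 u_inv thu; pose ev := GHom (eval_equivariant u_inv).
have [f0 f0E] := dual_onto (linearP th).
have [|f [f_inv evf]] := @lift_invariant _ _ A_flat _ _ ev f0 H1; first by [].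
suff eqf : @gequivariant k G F (trivial G k^o) (dual_fun f).
  by exists (GHom eqf); rewrite -thu -f0E.
have SE x : contragredient f x = (dual_fun f x : k)%:A.
  by rewrite -dual_coactE (f_inv : dual_coact f = _) dual_eval_pure.
move=> x; rewrite map_functional.
transitivity ((1 : k^o) *t ((dual_fun f x : k)%:A : A)).
  by rewrite [RHS]linearZr -[RHS]linearZl_LR; congr (_ *t _); rewrite -[RHS]/(_ * 1) mulr1.
congr (_ *t _); apply/esym.
(* Invariance of [f] reads [f(x_0) S(x_1) = f(x)]. Hence [f(x_0) x_1 = f(x_0) S(x_1) x_2 = f(x_0)
   ε(x_1) = f(x)], which is equivariance. *)
transitivity (tens_lift (fun y b => tens_lift (fun y' a =>
    (dual_fun f y' : k) *: (S a * b)) (coact F y)) (coact F x)).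
  apply: eq_lift => y b; transitivity (contragredient f y * b).
    by rewrite SE -scalerAl mul1r.
  rewrite /contragredient /tens_lift mulr_suml; apply: eq_bigr => p _.
  by rewrite scalerAl.
rewrite (@coassoc_lift _ _ _ _ (fun y a b => (dual_fun f y : k) *: (S a * b))); first last.
- by move=> y a c u' v; rewrite mulrDr scalerDr -scalerAr !scalerA mulrC.
- by move=> y b c u' v; rewrite linearP mulrDl scalerDr -scalerAl !scalerA mulrC.
- by move=> a b c u' v; rewrite linearP scalerDl -[(_ *: _ : k^o)]/(c * _) scalerA.
rewrite -[in RHS](coactK x) /counit_lift linear_lift.
rewrite [RHS]scaler_suml; apply: eq_bigr => -[y b] _ /=.
rewrite -[LHS]/(tens_lift (fun a1 a2 => _ *: (S a1 * a2)) (comul G b)).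
rewrite /tens_lift -scaler_sumr -/(tens_lift (fun a1 a2 => S a1 * a2) _) antipodel.
rewrite scalerA; congr (_ *: _).
rewrite -[RHS]/(dual_fun f (counit G b *: y)) (linearZ_LR (dual_fun f)); exact: mulrC.
Qed.

End DualModule.

(** * Invariant integrals and Reynolds operators *)

Section Products.
Variables (k : comNzRingType) (G : affine_group k).
Notation A := (coord_ring G).
Implicit Types U V W : gmodule G.

Lemma copair_linear U V W (f : ghom U W) (g : ghom V W) :
  linear (fun x : gprod U V => f x.1 + g x.2).
Proof. by move=> a x y; rewrite !linearP scalerDr addrACA. Qed.

Lemma copair_equivariant U V W (f : ghom U W) (g : ghom V W) :
  @gequivariant k G (gprod U V) W (lin_of (copair_linear f g)).
Proof.
pose c := lin_of (copair_linear f g).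
have cl x : c (prod_inl U V x) = f x by rewrite /= linear0 addr0.
have cr y : c (prod_inr U V y) = g y by rewrite /= linear0 add0r.
apply: (@prod_eq _ _ _ _ _ (coact W \o c)
  (tens_map c (@idfun A) \o @prod_coact _ _ U V)) => x.
  transitivity (tens_map c (@idfun A) (prod_coact (prod_inl U V x))) => //.
  rewrite prod_coact_inl tens_map_comp -[LHS]/(coact W (c (prod_inl U V x))) cl ghomP.
  by apply: eq_tens_map => // z; rewrite [RHS]cl.
transitivity (tens_map c (@idfun A) (prod_coact (prod_inr U V x))) => //.
rewrite prod_coact_inr tens_map_comp -[LHS]/(coact W (c (prod_inr U V x))) cr ghomP.
by apply: eq_tens_map => // z; rewrite [RHS]cr.
Qed.

Definition copair U V W (f : ghom U W) (g : ghom V W) : ghom (gprod U V) W :=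
  GHom (copair_equivariant f g).

Lemma gid_equivariant V : @gequivariant k G V V idfun.
Proof. by move=> v; rewrite tens_map_id. Qed.

Lemma gzero_linear V W : linear (fun _ : V => 0 : W).
Proof. by move=> a x y; rewrite scaler0 addr0. Qed.

Lemma gzero_equivariant V W : @gequivariant k G V W (lin_of (@gzero_linear V W)).
Proof. by move=> v; rewrite tens_map0 //= linear0. Qed.

Definition gid V : ghom V V := @GHom _ _ V V idfun (@gid_equivariant V).
Definition gzero V W : ghom V W := GHom (@gzero_equivariant V W).

Definition gfst V W : ghom (gprod V W) V := copair (gid V) (gzero W V).
Definition gsnd V W : ghom (gprod V W) W := copair (gzero V W) (gid W).

Lemma ginvariant_hom V W (f : ghom V W) v : ginvariant v -> ginvariant (f v).
Proof. by move=> v_inv; rewrite /ginvariant ghomP v_inv tens_map_pure. Qed.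

Lemma ginvariant_prod V W (x : gprod V W) : ginvariant x -> ginvariant x.1 /\ ginvariant x.2.
Proof.
move=> x_inv; split.
  by have := ginvariant_hom (gfst V W) x_inv; rewrite /= addr0.
by have := ginvariant_hom (gsnd V W) x_inv; rewrite /= add0r.
Qed.

Lemma pair_linear U V W (f : ghom U V) (g : ghom U W) :
  linear (fun x => (f x, g x) : gprod V W).
Proof. by move=> a x y; rewrite !linearP. Qed.

Lemma pair_equivariant U V W (f : ghom U V) (g : ghom U W) :
  @gequivariant k G U (gprod V W) (lin_of (pair_linear f g)).
Proof.
move=> x; transitivity (tens_map (prod_inl V W) idfun (coact V (f x)) +
  tens_map (prod_inr V W) idfun (coact W (g x))) => //.
rewrite !ghomP !tens_map_comp.
rewrite /tens_map /tens_lift -big_split /=; apply: eq_bigr => p _.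
rewrite -linearDl; congr (_ *t _).
exact: esym (prod_inlr ((f p.1, g p.1) : V * W)).
Qed.

Definition pair_hom U V W (f : ghom U V) (g : ghom U W) : ghom U (gprod V W) :=
  GHom (pair_equivariant f g).

Lemma functional_contract U (f : ghom U (trivial G k^o)) x :
  tens_lift (fun y a => (f y : k) *: a) (coact U x) = (f x : k)%:A.
Proof.
have b : bilin (fun (c : k^o) (a : A) => (c : k) *: a)
  by apply: functional_bilinl idfun idfun.
by rewrite -(@lift_map _ _ _ _ _ _ _ f idfun) // -ghomP /= (tens_lift_pure b).
Qed.

End Products.

(** * Local finiteness and construction of the integral *)

Section Integral.
Variables (k : comNzRingType) (G : affine_group k).
Notation A := (coord_ring G).
Notation S := (antipode G).
Hypothesis A_flat : flat_module A.
Hypothesis k_noeth : noetherian_ring k.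
Hypothesis H1 : forall V : gmodule G, cohomology_vanishes 1 V.

(* The submodule is {w | coact w ∈ E ⊗ A}, where [E] is the span of [e]. *)
Lemma local_finiteness (W : gmodule G) n (e : 'I_n -> W) :
  exists (F : gmodule G) (i : ghom F W), [/\ injective i, finitely_generated F &
    forall x (c : 'I_n -> A), coact W x = \sum_j e j *t c j -> exists y, i y = x].
Proof.
pose p (v : 'rV[k]_n) := \sum_j v 0 j *: e j.
have pl : linear p.
  move=> a u v; rewrite /p scaler_sumr -big_split /=; apply: eq_bigr => j _.
  by rewrite !mxE scalerDl scalerA.
have Esub : submodule (fun w => exists v, p v = w).
  split=> [|a _ _ [u <-] [v <-]]; first by exists 0; apply: (linear0 (lin_of pl)).
  by exists (a *: u + v); apply: pl.
pose q : {linear W -> quotmod Esub} := quot_pi Esub.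
have q0 w : q w = 0 <-> exists v, p v = w by apply: quot_pi0.
(* The submodule is the kernel of [(q ⊗ A) ∘ coact]; being the kernel of an equivariant map, it is
   stable. *)
pose g := coact_hom q; pose F := gker A_flat g; pose i := gker_incl A_flat g.
(* Applying the counit to the coaction recovers the vector, so [F] lies in [E] and is finitely
   generated over the noetherian [k]. *)
have iE (x : F) : exists v, p v = i x.
  apply/q0; rewrite -[i x]coactK -counit_lift_map.
  by rewrite -[tens_map _ _ _]/(g (i x)) (sub_inclP x : g (i x) = 0) linear0.
exists F, i; split; first exact: sub_incl_inj.
  have E_fg : finitely_generated (submod Esub).
    exists n; have vP v : exists z, sub_incl Esub z = p v.
      by apply: sub_incl_onto; exists v.
    pose h v := sval (cid (vP v)).
    have hE v : sub_incl Esub (h v) = p v := svalP (cid (vP v)).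
    have hl : linear h.
      by move=> a u v; apply: sub_incl_inj; rewrite linearP !hE pl.
    exists (lin_of hl) => x; have [v vE] := sub_inclP x.
    by exists v; apply: sub_incl_inj; rewrite [LHS]hE vE.
  have xP (x : F) : exists z, sub_incl Esub z = i x by apply: sub_incl_onto.
  pose h x := sval (cid (xP x)).
  have hE x : sub_incl Esub (h x) = i x := svalP (cid (xP x)).
  have hl : linear h.
    by move=> a u v; apply: sub_incl_inj; rewrite linearP !hE linearP.
  apply: (finitely_generated_sub k_noeth (i := lin_of hl)) E_fg => x y /= xy.
  by apply/(@sub_incl_inj _ _ _ (ker_submodule g)); rewrite -[LHS]hE xy hE.
move=> x c xE; apply: (@sub_incl_onto _ _ _ (ker_submodule g)).
rewrite /= xE linear_sum big1 //= => j _; rewrite tens_map_pure.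
suff -> : q (e j) = 0 by rewrite linear0l.
apply/q0; exists (delta_mx 0 j); rewrite /p (bigD1 j) //= mxE !eqxx scale1r.
by rewrite big1 ?addr0 // => l lj; rewrite mxE (negPf lj) andbF scale0r.
Qed.

Lemma regular_invariant (a : A) : @ginvariant _ _ (regular G) a -> a = (counit G a)%:A.
Proof.
move=> a_inv; rewrite -[LHS](counitl a) (a_inv : comul G a = _).
have b : bilin (fun x y : A => counit G x *: y).
  split=> [y|x] c u v /=; first by rewrite linearP scalerDl -scalerA.
  by rewrite scalerDr !scalerA mulrC.
by rewrite (tens_lift_pure b).
Qed.

(* A fragment of an invariant integral on [A], defined on the image of [i]. *)
Definition partial_integral (F : gmodule G) (i : ghom F (regular G))
    (f : ghom F (trivial G k^o)) :=
  forall x, ginvariant x -> i x = (f x : k)%:A.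

(** The integral is glued as a graph, the union of the graphs of all fragments. It remains to see
    that this relation is linear, single-valued and total. *)
Definition integral_graph (a : A) (c : k) :=
  exists (F : gmodule G) (i : ghom F (regular G)) (f : ghom F (trivial G k^o)),
    partial_integral i f /\ exists2 x, i x = a & f x = c.

(** Two fragments combine on the direct sum of their domains. The combined map to [A] is in general
    not injective, which is why [i] is arbitrary in [partial_integral]. *)
Lemma integral_graph_linear r a c a' c' : integral_graph a c -> integral_graph a' c' ->
  integral_graph (r *: a + a') (r * c + c').
Proof.
move=> [F [i [f [fP [x xa xc]]]]] [F' [i' [f' [fP' [x' xa' xc']]]]].
exists (gprod F F'), (copair i i'), (copair f f'); split.
  move=> z /ginvariant_prod[z1 z2] /=.
  by rewrite fP // fP' // -scalerDl.
by exists (r *: x + 0, r *: 0 + x');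
  rewrite /= !(scaler0, addr0, add0r) linearZ /= ?xa ?xa' ?xc ?xc'.
Qed.

(** If [i x = 0], then [(i x, f x) = (0, c)] is invariant, so it is also the image of an invariant
    [y]. On invariants [i] determines [f], whence [c = 0]. *)
Lemma integral_graph0 c : integral_graph 0 c -> c = 0.
Proof.
move=> [F [i [f [fP [x x0 xc]]]]].
have [|y [y_inv]] := @lift_invariant _ _ A_flat _ _ (pair_hom i f) x H1.
  transitivity (tens_map (prod_inl (regular G) (trivial G k^o)) (@idfun A)
      (coact (regular G) (i x)) +
    tens_map (prod_inr (regular G) (trivial G k^o)) (@idfun A) (f x *t 1)) => //.
  by rewrite x0 !linear0 add0r tens_map_pure /= x0.
case=> y0 yc; have := fP y y_inv; rewrite y0 yc x0 xc => /(congr1 (counit G)).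
by rewrite linear0 linearZ /= rmorph1 mulr1 => <-.
Qed.

Lemma integral_graph_total a : exists (F : gmodule G) (i : ghom F (regular G))
  (f : ghom F (trivial G k^o)), [/\ partial_integral i f, exists x, i x = a
    & exists2 u, i u = 1 & f u = 1].
Proof.
(* The extra entry contributes [1 ⊗ 0 = 0] to the sum but puts 1 into the span of the first
   components, so that [F] contains 1 as well as [a]. *)
pose s := (1, 0) :: repr (comul G a) : seq (A * A).
have aE : comul G a = \sum_(j < size s) (nth 0 s j).1 *t (nth 0 s j).2.
  rewrite [LHS]tens_sum_repr -[LHS]add0r -{1}(linear0r (@pure _ _ _) (1 : A)).
  rewrite -(big_mkord xpredT (fun j => (nth 0 s j).1 *t (nth 0 s j).2)).
  by rewrite -(big_nth 0 xpredT (fun p => p.1 *t p.2)) big_cons.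
have [F [i [i_inj F_fg iE]]] :=
  @local_finiteness (regular G) _ (fun j : 'I_(size s) => (nth 0 s j).1).
have [x xE] : exists x, i x = a by apply: iE aE.
have [u uE] : exists u, i u = 1.
  apply: (iE _ (fun j => if j == ord0 then 1 else 0)) => /=.
  rewrite comul1 big_ord_recl /= big1 ?addr0 // => j _; exact: linear0r.
have u_inv : ginvariant u.
  by apply: (A_flat i_inj); rewrite -ghomP tens_map_pure uE /= comul1.
have th_lin : linear (fun y => counit G (i y) : k^o) by move=> c y z; rewrite !linearP.
have [|f fu] := @equivariant_functional _ _ A_flat k_noeth F F_fg u (lin_of th_lin) H1 u_inv.
  by rewrite /= uE rmorph1.
exists F, i, f; split; last 2 first.
- by exists x.
- by exists u.
(* Invariants of [A] are constants, so every invariant of [F] is a multiple of [u], where [f] takes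
   the value 1. *)
move=> y y_inv; have iy := regular_invariant (ginvariant_hom i y_inv).
have yE : y = counit G (i y) *: u by apply: i_inj; rewrite linearZ /= uE -iy.
by rewrite [in RHS]yE linearZ /= fu -[(_ *: _ : k^o)]/(_ * 1) mulr1.
Qed.

Lemma right_integral : exists mu : {linear A -> k^o}, mu 1 = 1 /\
  forall a, tens_lift (fun x y => (mu x : k) *: y) (comul G a) = (mu a : k)%:A.
Proof.
have tot a : exists c, integral_graph a c.
  have [F [i [f [fP [x xE] _]]]] := integral_graph_total a.
  by exists (f x), F, i, f; split=> //; exists x.
have funct a c d : integral_graph a c -> integral_graph a d -> c = d.
  move=> ac ad; have := integral_graph_linear (-1) ac ad.
  rewrite scaleN1r addNr mulN1r => /integral_graph0 /eqP.
  by rewrite addrC subr_eq0 => /eqP.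
pose mu a : k^o := sval (cid (tot a)).
have muP a : integral_graph a (mu a) := svalP (cid (tot a)).
have mu_lin : linear mu.
  by move=> r a b; apply: funct (muP _) _; apply: integral_graph_linear.
exists (lin_of mu_lin).
(* Since [mu] restricts to [f] on every fragment, it inherits normalization and invariance from the
   functionals [f]. *)
have muE F (i : ghom F (regular G)) f x : partial_integral i f -> mu (i x) = f x.
  by move=> fP; apply: funct (muP _) _; exists F, i, f; split=> //; exists x.
split=> [|a].
  have [F [i [f [fP _ [u <- <-]]]]] := integral_graph_total 0.
  exact: muE.
have [F [i [f [fP [x <-] _]]]] := integral_graph_total a.
have b : bilin (fun x y : A => (lin_of mu_lin x : k) *: y)
  by apply: functional_bilinl idfun.
rewrite -[comul G _]/(coact (regular G) (i x)) ghomP lift_map //=.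
rewrite (muE _ _ _ _ fP) -functional_contract.
by apply: eq_lift => y c; rewrite /= (muE _ _ _ _ fP).
Qed.

Lemma invariant_integral : exists mu : {linear A -> k^o}, [/\ mu 1 = 1,
  forall a, tens_lift (fun x y => (mu x : k) *: y) (comul G a) = (mu a : k)%:A &
  forall a, tens_lift (fun x y => (mu y : k) *: x) (comul G a) = (mu a : k)%:A].
Proof.
have [mu [mu1 mur]] := right_integral; exists mu; split=> // a.
have br : bilin (fun x y : A => (mu x : k) *: y)
  by apply: functional_bilinl idfun.
(* [mu o S] is left invariant since [S] reverses the comultiplication. *)
have muSl b : tens_lift (fun x y => (mu (S y) : k) *: x) (comul G b) = (mu (S b) : k)%:A.
  have SE c : tens_lift (fun x y => (mu (S y) : k) *: S x) (comul G c) = (mu (S c) : k)%:A.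
    rewrite -mur comul_antipode lift_lift //; apply: eq_lift => x y.
    by rewrite (tens_lift_pure br).
  (* [SE] is the desired identity with [S] applied to the free factor. Multiplying by [b_1] removes
     this [S] without inverting it: [b_1 mu(S b_2) = b_1 S(b_2) mu(S b_3) = mu(S b)]. *)
  pose T x y z : A := (mu (S z) : k) *: (x * S y).
  transitivity (tens_lift (fun x y => tens_lift (T x) (comul G y)) (comul G b)).
    apply: eq_lift => x y; transitivity (x * (mu (S y) : k)%:A).
      by rewrite -scalerAr mulr1.
    rewrite -SE /tens_lift mulr_sumr; apply: eq_bigr => p _.
    by rewrite -scalerAr.
  rewrite -(@coassoc_lift _ _ (regular G)) /=; first last.
  - move=> x y c u v.
    by rewrite /T linearP linearP scalerDl -[(_ *: _ : k^o)]/(c * _) -scalerA.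
  - by move=> x z c u v; rewrite /T linearP mulrDr scalerDr -scalerAr !scalerA mulrC.
  - by move=> y z c u v; rewrite /T mulrDl scalerDr -scalerAl !scalerA mulrC.
  rewrite -[in RHS](counitl b) linear_lift linear_lift [RHS]scaler_suml.
  apply: eq_bigr => -[x y] _ /=.
  rewrite [LHS](_ : _ = (mu (S y) : k) *: tens_lift (fun x' y' => x' * S y') (comul G x)).
    by rewrite antipoder scalerA !linearZ mulrC.
  by rewrite /tens_lift scaler_sumr.
suff muS b : mu (S b) = mu b by rewrite -muS -muSl; apply: eq_lift => x y; rewrite muS.
(* The sum of [mu(b_1) mu(S b_2)] is computed in two ways: [muSl] gives [mu(S b)], and [mur] gives
   [mu(b)]. *)
transitivity (mu (tens_lift (fun x y => (mu (S y) : k) *: x) (comul G b))).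
  by rewrite muSl linearZ /= mu1 -[RHS]/(_ * 1) mulr1.
transitivity (mu (S (tens_lift (fun x y => (mu x : k) *: y) (comul G b)))); last first.
  by rewrite mur !linearZ /= rmorph1 mu1 -[LHS]/(_ * 1) mulr1.
rewrite !linear_lift; apply: eq_lift => x y.
by rewrite !linearZ /= -[LHS]/(_ * _) mulrC.
Qed.

(** * Averaging against an integral *)

Section Average.
Variable mu : {linear A -> k^o}.
Hypothesis mu1 : mu 1 = 1.
Hypothesis mu_r : forall a,
  tens_lift (fun x y => (mu x : k) *: y) (comul G a) = (mu a : k)%:A.
Hypothesis mu_l : forall a,
  tens_lift (fun x y => (mu y : k) *: x) (comul G a) = (mu a : k)%:A.

Definition average (V : gmodule G) (v : V) : V :=
  tens_lift (fun u a => (mu a : k) *: u) (coact V v).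

Lemma average_linear (V : gmodule G) : linear (@average V).
Proof.
exact: linear_comp (tens_lift_linear (functional_bilinr mu idfun)) (linearP (coact V)).
Qed.

Lemma average_coassoc (V : gmodule G) (v : V) :
  tens_lift (fun u a => tens_lift (fun u' b => (mu a : k) *: (u' *t b)) (coact V u))
    (coact V v) =
  tens_lift (fun u c => tens_lift (fun b a => (mu a : k) *: (u *t b)) (comul G c))
    (coact V v).
Proof.
rewrite (@coassoc_lift _ _ V _ (fun u b a => (mu a : k) *: (u *t b))) //.
- by move=> a b c u' w; rewrite linearPl scalerDr !scalerA mulrC.
- by move=> u a c b b'; rewrite linearPr scalerDr !scalerA mulrC.
- by move=> u b c a a'; rewrite linearP scalerDl -[(_ *: _ : k^o)]/(c * _) -scalerA.
Qed.

Lemma pure_average (V : gmodule G) (v : V) : average v *t (1 : A) =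
  tens_lift (fun u c => (mu c : k) *: (u *t (1 : A))) (coact V v).
Proof.
rewrite -[LHS]/(lin_of (pure_linl (1 : A)) _) linear_lift; apply: eq_lift => u a.
exact: linearZl_LR.
Qed.

(** The coaction of the average is the sum of [mu(v_2) v_0 ⊗ v_1], and [mu_l] replaces [mu(v_2) v_1]
    by the scalar [mu(v_1)]. *)
Lemma average_invariant (V : gmodule G) (v : V) : ginvariant (average v).
Proof.
rewrite /ginvariant pure_average linear_lift.
transitivity (tens_lift (fun u a => tens_lift (fun u' b => (mu a : k) *: (u' *t b))
                (coact V u)) (coact V v)).
  apply: eq_lift => u a; rewrite linearZ /= -[in LHS](lift_pure (coact V u)).
  by rewrite /tens_lift scaler_sumr.
rewrite average_coassoc; apply: eq_lift => u c.
transitivity (u *t tens_lift (fun b a => (mu a : k) *: b) (comul G c)).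
  rewrite -[RHS]/(lin_of (pure_linr u) _) linear_lift; apply: eq_lift => b a.
  by rewrite /= linearZr.
by rewrite mu_l linearZr.
Qed.

(** The left side is the sum of [mu(v_1) v_0 ⊗ v_2], so here the other invariance [mu_r] is what
    collapses it. *)
Lemma average_equivariant (V : gmodule G) (v : V) :
  tens_map (lin_of (@average_linear V)) (@idfun A) (coact V v) = average v *t 1.
Proof.
rewrite pure_average.
transitivity (tens_lift (fun u c => tens_lift (fun b a => (mu b : k) *: (u *t a))
                (comul G c)) (coact V v)).
  rewrite -(@coassoc_lift _ _ V _ (fun u b a => (mu b : k) *: (u *t a))); first last.
  - by move=> u a c b b'; rewrite linearPr scalerDr !scalerA mulrC.
  - by move=> u b c a a'; rewrite linearP scalerDl -[(_ *: _ : k^o)]/(c * _) -scalerA.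
  - by move=> a b c u' w; rewrite linearPl scalerDr !scalerA mulrC.
  apply: eq_lift => u a /=; rewrite /average.
  rewrite -[LHS]/(lin_of (pure_linl a) _) linear_lift; apply: eq_lift => u' b.
  exact: linearZl_LR.
apply: eq_lift => u c.
transitivity (u *t tens_lift (fun b a => (mu b : k) *: a) (comul G c)).
  rewrite -[RHS]/(lin_of (pure_linr u) _) linear_lift; apply: eq_lift => b a.
  by rewrite /= linearZr.
by rewrite mu_r linearZr.
Qed.

Lemma average_id (V : gmodule G) (v : V) : ginvariant v -> average v = v.
Proof.
move=> v_inv; rewrite /average v_inv (tens_lift_pure (functional_bilinr mu idfun)).
by rewrite mu1 scale1r.
Qed.

Lemma average_natural (V W : gmodule G) (f : ghom V W) (v : V) :
  average (f v) = f (average v).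
Proof.
rewrite /average ghomP (lift_map _ _ _ (functional_bilinr mu idfun)) linear_lift.
by apply: eq_lift => u a /=; rewrite linearZ.
Qed.

Definition inv_average (V : gmodule G) (v : V) : invariants V :=
  Invariants (introT (invariantP (average v)) (average_invariant v)).

Lemma inv_average_linear (V : gmodule G) : linear (@inv_average V).
Proof. by move=> a u v; apply: val_inj; apply: average_linear. Qed.

Lemma inv_val_linear (V : gmodule G) : linear (@inv_val _ _ V).
Proof. by []. Qed.

(** By flatness [V^G ⊗ A] embeds in [V ⊗ A], where the identity is [average_equivariant]. *)
Lemma inv_average_equivariant (V : gmodule G) :
  @gequivariant _ _ V (invmod V) (lin_of (@inv_average_linear V)).
Proof.
move=> v; have inv_val_inj : injective (lin_of (@inv_val_linear V)) by apply: val_inj.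
apply: (A_flat inv_val_inj); rewrite tens_map_pure [RHS]tens_map_comp.
rewrite -[LHS]/(average v *t 1) -average_equivariant.
by apply: eq_tens_map.
Qed.

Lemma average_reynolds : has_functorial_reynolds G.
Proof.
have idP (V : gmodule G) (w : invmod V) : inv_average (inv_val w) = w.
  by apply/val_inj/average_id/invariantP/inv_valP.
unshelve eexists.
  move=> V; apply: (@Reynolds _ _ V (GHom (@inv_average_equivariant V))).
    by move=> w; exists (inv_val w); apply: idP.
  exact: idP.
by move=> V W f v; apply: average_natural.
Qed.

End Average.

Lemma functorial_reynolds : has_functorial_reynolds G.
Proof.
have [mu [mu1 mu_r mu_l]] := invariant_integral.
exact: average_reynolds mu1 mu_r mu_l.
Qed.

End Integral.

(** * The two implications *)

Theorem theorem3p8 (k : comNzRingType) (G : affine_group k)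
    (G_algebraic : algebraic_group G) (G_smooth : smooth_group G) :
  (has_functorial_reynolds G -> linearly_reductive G) /\
  (dedekind_domain k -> linearly_reductive G -> has_functorial_reynolds G).
Proof.
split=> [[R Rnat]|[_ k_noeth _ _] [A_flat H1]]; last exact: functorial_reynolds.
split=> [|V I x [x_inv dx]]; first by case: G_smooth.
have [y dy] := (@res_exact _ _ _ I 0%N x).1 dx.
exists (inv_val (R _ y)); first exact/invariantP/inv_valP.
have := Rnat _ _ (res_diff I 0) y; rewrite dy => <-.
(* [x] is repackaged as an element of the module of invariants, on which the Reynolds operator is
   the identity. *)
have [x' ->] : exists x' : invmod (res_obj I 1), x = inv_val x'.
  by exists (Invariants (introT (invariantP x) x_inv)).
by congr inv_val; apply: reynolds_id.
Qed.
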